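(* Let $G$ be a connected Lie group with Lie algebra $\mathfrak{g}$ acting freely and properly on the left on a smooth manifold $M$, and let $L:TM\to\mathbb{R}$ be a smooth $G$-invariant Lagrangian. Assume that $L$ is regular and that the restriction of its Hessian to the directions tangent to the group orbits is non-degenerate everywhere, i.e. for a basis $\{E_a\}$ of $\mathfrak{g}$ the matrix $(g_{ab})$, $g_{ab}(u)=g_u(\tilde E_a,\tilde E_b)$, is non-singular at every $u\in TM$. For $\mu\in\mathfrak{g}^*$ let $N_\mu=\{u\in TM: p(u)=\mu\}$ be the level set of the momentum $p:TM\to\mathfrak{g}^*$ (a submanifold of $TM$ under these assumptions), and let $\mathcal{E}^\mu=\mathcal{E}|_{N_\mu}$ be the restriction to it of the energy $\mathcal{E}$ of $L$. Then for every $\mu\in\mathfrak{g}^*$, a point $u\in N_\mu$ is a relative equilibrium point if and only if $u$ is a critical point of $\mathcal{E}^\mu$.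
   Context: Notation: $\tau:TM\to M$ is the tangent bundle. For $\xi\in\mathfrak{g}$, $\tilde\xi$ is the fundamental vector field on $M$, i.e. the infinitesimal generator of the 1-parameter group of transformations of $M$ given by the action of $\exp(t\xi)$. For a vector field $Z$ on $M$, the complete lift $Z^{C}$ is the vector field on $TM$ whose flow consists of the tangent maps of the flow of $Z$; the vertical lift $Z^{V}$ is the vector field on $TM$ tangent to the fibres of $\tau$ and equal on the fibre $T_mM$ to the constant vector field $Z_m$. Invariance: $L$ is invariant under the induced (tangent) action of $G$ on $TM$; equivalently $\tilde\xi^{C}(L)=0$ for all $\xi\in\mathfrak{g}$. Hessian and regularity: for $u\in T_mM$, the Hessian $g_u$ is the symmetric bilinear form on $T_mM$ given by $g_u(v,w)=\frac{\partial^2}{\partial s\,\partial t}\big|_{s=t=0}L(u+sv+tw)$, i.e. with components $\partial^2L/\partial u^\alpha\partial u^\beta$ in coordinates $(x^\alpha,u^\alpha)$ on $TM$. $L$ is regular if $g_u$ is non-singular for every $u\in TM$. In $g_u(\tilde E_a,\tilde E_b)$ the fundamental vector fields are evaluated at $\tau(u)$. Euler-Lagrange field: for regular $L$, $\Gamma$ is the unique vector field on $TM$ of the form $\Gamma=u^\alpha\,\partial/\partial x^\alpha+\Gamma^\alpha\,\partial/\partial u^\alpha$ satisfying $\Gamma(\partial L/\partial u^\alpha)-\partial L/\partial x^\alpha=0$. Momentum: $p:TM\to\mathfrak{g}^*$ is defined by $\langle p(u),\eta\rangle=\tilde\eta^{V}(L)(u)$ for $\eta\in\mathfrak{g}$;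 its components are $p_a=\tilde E_a^{V}(L)$. Energy: $\mathcal{E}=\Delta(L)-L$, where $\Delta=u^\alpha\,\partial/\partial u^\alpha$ is the Liouville field. Relative equilibrium point: a point $u\in TM$ such that $\Gamma_u=\tilde\xi^{C}_u$ for some $\xi\in\mathfrak{g}$. (Equivalently, the curve on $M$ that is the projection of the integral curve of $\Gamma$ through $u$ is an integral curve of some fundamental vector field $\tilde\xi$.) *)

(* Defs.v *)
From HB Require Import structures.
From mathcomp Require Import all_boot all_order all_algebra.
From mathcomp Require Import all_classical all_reals all_analysis.

Set Implicit Arguments.
Unset Strict Implicit.
Unset Printing Implicit Defensive.

Import Order.TTheory GRing.Theory Num.Theory.
Import numFieldNormedType.Exports.

Local Open Scope classical_set_scope.
Local Open Scope ring_scope.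

(** * Smooth maps between open subsets of finite-dimensional normed spaces *)

(* [Ck_on k U f] is meant for U open and V finite-dimensional: then continuity
   of x |-> 'd f x v for each fixed v is continuity of the differential.      *)
Fixpoint Ck_on {R : realType} {V W : normedModType R} (k : nat) (U : set V)
    (f : V -> W) : Prop :=
  match k with
  | 0 => forall x, U x -> {for x, continuous f}
  | k'.+1 => (forall x, U x -> differentiable f x) /\
             (forall v : V, Ck_on k' U (fun x => 'd f x v))
  end.

Definition smooth_on {R : realType} {V W : normedModType R} (U : set V)
  (f : V -> W) : Prop := forall k, Ck_on k U f.

(** * Charts and manifolds *)

(* [bwd] is a total function; only its values on the image of [dom] matter. *)
Record chart (E T : Type) := Chart {
  dom : set T;
  fwd : T -> E;
  bwd : E -> T }.

(* An atlas modelled on E, with a preferred chart around each point.  The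
   preferred chart at x serves to identify the tangent space at x with E: a
   tangent vector at x is given by its components in [chart_at A x].  The
   axioms of a manifold are in [smooth_manifold] below.                       *)
Record manifold_data (E T : Type) := ManifoldData {
  atlas : set (chart E T);
  chart_at : T -> chart E T }.

Definition smooth_manifold {R : realType} {E : normedModType R}
    {T : topologicalType} (A : manifold_data E T) : Prop :=
  [/\ hausdorff_space T /\ @second_countable T,
      forall x, atlas A (chart_at A x) /\ dom (chart_at A x) x,
      forall c, atlas A c ->
        [/\ open (dom c), open (fwd c @` dom c),
            forall x, dom c x -> bwd c (fwd c x) = x,
            forall x, dom c x -> {for x, continuous (fwd c)} &
            forall y, (fwd c @` dom c) y -> {for y, continuous (bwd c)}] &
      forall c c', atlas A c -> atlas A c' ->
        smooth_on (fwd c @` (dom c `&` dom c')) (fwd c' \o bwd c)].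

(* A normed space as a manifold, with the identity as its only chart. *)
Definition id_chart (E : Type) : chart E E := Chart setT id id.

Definition model_data (E : Type) : manifold_data E E :=
  ManifoldData [set id_chart E] (fun=> id_chart E).

Definition prod_chart {E F T S : Type} (c : chart E T) (d : chart F S) :
    chart (E * F) (T * S) :=
  Chart (dom c `*` dom d)
        (fun x => (fwd c x.1, fwd d x.2))
        (fun y => (bwd c y.1, bwd d y.2)).

Definition prod_data {E F T S : Type} (A : manifold_data E T)
    (B : manifold_data F S) : manifold_data (E * F) (T * S) :=
  ManifoldData
    [set e | exists c d, [/\ atlas A c, atlas B d & e = prod_chart c d]]
    (fun x => prod_chart (chart_at A x.1) (chart_at B x.2)).

(** * Smooth maps and their tangent maps *)

Section SmoothMaps.
Context {R : realType} {E F : normedModType R} {T S : Type}.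
Variables (A : manifold_data E T) (B : manifold_data F S).

(* Smoothness on an open subset W of T.  Openness of the chart images of the
   sets W `&` f @^-1` (dom c') expresses continuity of f on W, so that no
   topology on T and S is needed beyond the one given by the atlases.         *)
Definition msmooth_on (W : set T) (f : T -> S) : Prop :=
  forall c c', atlas A c -> atlas B c' ->
    let D := fwd c @` (dom c `&` W `&` f @^-1` dom c') in
    open D /\ smooth_on D (fwd c' \o f \o bwd c).

Definition msmooth (f : T -> S) : Prop := msmooth_on setT f.

(* The tangent map T_x T -> T_(f x) S, in components with respect to the
   preferred charts at x and f x.                                             *)
Definition mdiff (f : T -> S) (x : T) : E -> F :=
  'd (fwd (chart_at B (f x)) \o f \o bwd (chart_at A x)) (fwd (chart_at A x) x).

End SmoothMaps.

(* The differential of a function with values in a normed space. *)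
Definition vdiff {R : realType} {E F : normedModType R} {T : Type}
    (A : manifold_data E T) (f : T -> F) (x : T) : E -> F :=
  mdiff A (model_data F) f x.

(** * The tangent bundle *)

(* The point (m, a) of [tangent A] is the tangent vector at m with components
   a in the chart [chart_at A m]; in particular the linear structure of the
   fibre T_m M is that of E.                                                  *)
Definition tangent {E T : Type} (A : manifold_data E T) : Type := (T * E)%type.

Section TangentBundle.
Context {R : realType} {E : normedModType R} {T : Type}.
Variable A : manifold_data E T.

(* The natural chart (x^alpha, u^alpha) of TM induced by a chart c of M. *)
Definition tangent_chart (c : chart E T) : chart (E * E)%type (tangent A) :=
  Chart [set u : tangent A | dom c u.1]
        (fun u : tangent A => (fwd c u.1, vdiff A (fwd c) u.1 u.2))
        (fun z : E * E =>
           (bwd c z.1, mdiff (model_data E) A (bwd c) z.1 z.2)).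

Definition tangent_data : manifold_data (E * E)%type (tangent A) :=
  ManifoldData (tangent_chart @` atlas A)
               (fun u : tangent A => tangent_chart (chart_at A u.1)).

Definition tangent_map (f : T -> T) (u : tangent A) : tangent A :=
  (f u.1, mdiff A A f u.1 u.2).

(* The velocity at time t of a curve, a vector in the tangent space at
   [gamma t].                                                                 *)
Definition velocity (gamma : R -> T) (t : R) : E :=
  mdiff (model_data R^o) A gamma t 1.

End TangentBundle.

(* The vector field with flow phi. *)
Definition generator {R : realType} {E : normedModType R} {T : Type}
    (A : manifold_data E T) (phi : R -> T -> T) (m : T) : E :=
  velocity A (fun t => phi t m) 0.

(* The complete lift of the vector field with flow phi. *)
Definition complete_lift {R : realType} {E : normedModType R} {T : Type}
    (A : manifold_data E T) (phi : R -> T -> T) (u : tangent A) : E * E :=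
  generator (tangent_data A) (fun t => tangent_map (phi t)) u.

(* The vertical lift at u of a vector z in the tangent space T_(tau u) M. *)
Definition vertical_lift {R : realType} {E : normedModType R} {T : Type}
    (A : manifold_data E T) (z : E) (u : tangent A) : E * E :=
  velocity (tangent_data A) (fun t : R => ((u.1, u.2 + t *: z) : tangent A)) 0.

(** * Lie groups and actions *)

(* Types with a group law and a topology, a priori unrelated. *)
#[short(type="topGroupType")]
HB.structure Definition TopGroup := {G of Group G & Topological G}.

Definition lie_group {R : realType} {E : normedModType R} {G : topGroupType}
    (A : manifold_data E G) : Prop :=
  [/\ smooth_manifold A,
      msmooth (prod_data A A) A (fun x : G * G => (x.1 * x.2)%g) &
      msmooth A A (fun x : G => x^-1%g)].

(* The Lie algebra is the tangent space at 1, that is E; [is_exp A exp] says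
   that t |-> exp (t xi) is the one-parameter subgroup with velocity xi, which
   determines exp.                                                            *)
Definition is_exp {R : realType} {E : normedModType R} {G : topGroupType}
    (A : manifold_data E G) (exp : E -> G) : Prop :=
  forall xi : E,
    [/\ msmooth (model_data R^o) A (fun t : R => exp (t *: xi)),
        forall s t : R,
          exp ((s + t) *: xi) = (exp (s *: xi) * exp (t *: xi))%g &
        velocity A (fun t : R => exp (t *: xi)) 0 = xi].

Definition smooth_left_action {R : realType} {E F : normedModType R}
    {G : topGroupType} {M : topologicalType} (GA : manifold_data E G)
    (MA : manifold_data F M) (act : G -> M -> M) : Prop :=
  [/\ msmooth (prod_data GA MA) MA (fun x : G * M => act x.1 x.2),
      forall m, act 1%g m = m &
      forall g h m, act (g * h)%g m = act g (act h m)].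

Definition free_action {G : topGroupType} {M : Type} (act : G -> M -> M) :
  Prop := forall g m, act g m = m -> g = 1%g.

Definition proper_action {G : topGroupType} {M : topologicalType}
    (act : G -> M -> M) : Prop :=
  forall K : set (M * M), compact K ->
    compact ((fun x : G * M => (act x.1 x.2, x.2)) @^-1` K).

Section FundamentalFields.
Context {R : realType} {E F : normedModType R} {G : topGroupType} {M : Type}.
Variables (MA : manifold_data F M) (exp : E -> G) (act : G -> M -> M).

(* The one-parameter group of transformations of M defined by xi; it is the
   flow of the fundamental vector field of xi.                                *)
Definition one_param (xi : E) (t : R) : M -> M := act (exp (t *: xi)).

Definition fund (xi : E) : M -> F := generator MA (one_param xi).

Definition fund_complete (xi : E) : tangent MA -> F * F :=
  complete_lift (one_param xi).

Definition fund_vertical (xi : E) (u : tangent MA) : F * F :=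
  vertical_lift (fund xi u.1) u.

End FundamentalFields.

(** * Lagrangian systems *)

Definition invariant_lagrangian {R : realType} {F : normedModType R}
    {G : topGroupType} {M : Type} (MA : manifold_data F M) (act : G -> M -> M)
    (L : tangent MA -> R) : Prop :=
  forall g u, L (tangent_map (act g) u) = L u.

Section Lagrangian.
Context {R : realType} {F : normedModType R} {M : Type}.
Context {MA : manifold_data F M}.
Variable L : tangent MA -> R^o.

Definition hessian (u : tangent MA) (v w : F) : R :=
  derive1 (fun s : R =>
    derive1 (fun t : R => L (u.1, u.2 + s *: v + t *: w)) 0) 0.

Definition regular : Prop :=
  forall u v, (forall w, hessian u v w = 0) -> v = 0.

(* Delta(L) - L: the Liouville field is the vertical lift of u at u. *)
Definition energy (u : tangent MA) : R :=
  vdiff (tangent_data MA) L u (vertical_lift u.2 u) - L u.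

Definition momentum {E : normedModType R} {G : topGroupType} (exp : E -> G)
    (act : G -> M -> M) (u : tangent MA) (eta : E) : R :=
  vdiff (tangent_data MA) L u (fund_vertical exp act eta u).

Definition momentum_level {E : normedModType R} {G : topGroupType}
    (exp : E -> G) (act : G -> M -> M) (mu : {linear E -> R^o}) :
  set (tangent MA) := [set u | forall eta, momentum exp act u eta = mu eta].

End Lagrangian.

(* For a chart c of M, with natural coordinates (x, u) on TM:
   Gamma(x) = u and Gamma(dL/du^alpha) = dL/dx^alpha for all alpha.           *)
Definition euler_lagrange_field {R : realType} {n : nat} {M : Type}
    {MA : manifold_data 'rV[R]_n M} (L : tangent MA -> R^o)
    (Gamma : tangent MA -> 'rV[R]_n * 'rV[R]_n) : Prop :=
  forall c, atlas MA c -> forall u : tangent MA, dom c u.1 ->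
    let Tc := tangent_chart MA c in
    let Lc := L \o bwd Tc in
    let e (i : 'I_n) : 'rV[R]_n := delta_mx 0 i in
    vdiff (tangent_data MA) (fun w => (fwd Tc w).1) u (Gamma u) = (fwd Tc u).2
    /\ forall i : 'I_n,
      vdiff (tangent_data MA)
        (fun w => 'D_((0, e i) : 'rV[R]_n * 'rV[R]_n) Lc (fwd Tc w) : R^o)
        u (Gamma u)
      = 'D_((e i, 0) : 'rV[R]_n * 'rV[R]_n) Lc (fwd Tc u).

Definition relative_equilibrium {R : realType} {E F : normedModType R}
    {G : topGroupType} {M : Type} {MA : manifold_data F M} (exp : E -> G)
    (act : G -> M -> M) (Gamma : tangent MA -> F * F) (u : tangent MA) : Prop :=
  exists xi : E, Gamma u = fund_complete exp act xi u.

(* For a submanifold N, the tangent vectors to N at u are the velocities of the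
   smooth curves in N through u, so this says that the differential of the
   restriction of f to N vanishes at u.                                       *)
Definition critical_point_on {R : realType} {E : normedModType R} {T : Type}
    (A : manifold_data E T) (N : set T) (f : T -> R) (u : T) : Prop :=
  N u /\
  forall (gamma : R -> T) (eps : R), 0 < eps ->
    msmooth_on (model_data R^o) A `]- eps, eps[ gamma ->
    (forall t, `]- eps, eps[%classic t -> N (gamma t)) ->
    gamma 0 = u ->
    derive1 (f \o gamma) 0 = 0.

(* Main.v *)
Require Import Defs.
From HB Require Import structures.
From mathcomp Require Import all_boot all_order all_algebra.
From mathcomp Require Import ring lra.
From mathcomp Require Import all_classical all_reals all_analysis.

(** Everything happens at one point u, in the natural coordinates z = (x, v)
    given by a chart of M.  Write D2L(a, b) for the second differential of the
    Lagrangian and put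

      omega(a, b) = D2L(b, (0, a_1)) - D2L(a, (0, b_1)),

    which is minus the exterior derivative of the Cartan 1-form
    (dL/du^alpha) dx^alpha.  Then

    - omega is non-degenerate at u because the Hessian of L is
      ([omega_nondegenerate]);
    - dE = omega(Gamma, _), by the Euler-Lagrange equations
      ([energy_omega]);
    - dp_eta = omega(eta^C, _) for every eta in the Lie algebra, by invariance
      of L, differentiated once along the fibre and once along the group
      ([mom_omega]).

    Hence Gamma_u = xi^C_u if and only if dE = dp_xi at u.  If this holds, dE
    vanishes on all vectors killed by every dp_eta, in particular on the
    velocities of curves in the level set of p.  Conversely, the derivative of
    p in the directions of the vertical lifts of the fundamental fields is the
    matrix (g_ab).  As it is invertible, two things follow.  Every vector killed
    by all dp_eta is the velocity of a smooth curve in the level set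
    ([level_curve]), by an implicit function theorem for curves
    ([implicit_curve]), so that dE vanishes on this vector when u is critical.
    And a linear form that vanishes on all these vectors is a linear combination
    of the dp_a, that is, equal to some dp_xi ([equilibrium_of_kernel]).

    Two further points make the coordinate computation legitimate.  The second
    derivatives of L and of the action commute ([diff_sym]); for the action this
    identifies the generator of the tangent action with the complete lift
    (X, DX v) of the generator X.  And energy, momentum, Hessian, fundamental
    fields and their lifts, which are all defined through the preferred chart at
    a varying point, have the expected expressions in one fixed chart
    ([energyE], [momentumE], [hessianE], [fundE], [fund_completeE]). *)

Set Implicit Arguments.
Unset Strict Implicit.
Unset Printing Implicit Defensive.

Import Order.TTheory GRing.Theory Num.Theory.
Import numFieldNormedType.Exports.

Local Open Scope classical_set_scope.
Local Open Scope ring_scope.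

(** * Differentials *)

Section Calculus.
Context {R : realType}.

(** The epsilon form of differentiability, suited to estimates in which several
    error terms are combined. *)
Lemma differentiable_eps (V W : normedModType R) (f : V -> W) x
    (L : {linear V -> W}) :
  continuous L ->
  (forall e : R, 0 < e -> \forall h \near 0,
     `|f (x + h) - f x - L h| <= e * `|h|) ->
  differentiable f x /\ 'd f x = L :> (V -> W).
Proof.
move=> Lc fL.
have E : f \o shift x = cst (f x) + L +o_ 0 id.
  apply/eqaddoP => e e0; near=> h.
  have -> : (f \o shift x - (cst (f x) + L)) h = f (x + h) - f x - L h.
    by rewrite -[LHS]/(f (h + x) - (f x + L h)) opprD addrA [h + x]addrC.
  by near: h; exact: fL.
have D := diff_unique Lc E.
by split=> //; apply/diff_locallyP; rewrite D.
Unshelve. all: by end_near. Qed.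

Lemma diff_eps (V W : normedModType R) (f : V -> W) x :
  differentiable f x -> forall e : R, 0 < e -> \forall h \near 0,
     `|f (x + h) - f x - 'd f x h| <= e * `|h|.
Proof.
move=> /diff_locallyP[_ /eqaddoP E] e e0; near=> h.
have -> : f (x + h) - f x - 'd f x h
   = (f \o shift x - (cst (f x) + 'd f x)) h.
  by rewrite -[RHS]/(f (h + x) - (f x + 'd f x h)) opprD addrA [h + x]addrC.
by near: h; exact: E.
Unshelve. all: by end_near. Qed.

Lemma near_shift0 (V : normedModType R) (x : V) (P : V -> Prop) :
  (\forall y \near x, P y) -> \forall h \near 0, P (x + h).
Proof.
move=> Px; have : (fun h : V => x + h) @ (0 : V) --> x.
  rewrite -[X in _ --> X]addr0; apply: cvgD; [exact: cvg_cst|exact: cvg_id].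
exact.
Qed.

Lemma differentiable_near (V W : normedModType R) (f g : V -> W) x :
  (\forall y \near x, f y = g y) -> differentiable f x ->
  differentiable g x /\ 'd g x = 'd f x :> (V -> W).
Proof.
move=> fg df; apply: (@differentiable_eps _ _ g x ('d f x)) => [|e e0].
  exact: (diff_continuous df).
have fgx := nbhs_singleton fg; near=> h.
rewrite -fgx; have <- : f (x + h) = g (x + h).
  by near: h; exact: (@near_shift0 _ x (fun y => f y = g y) fg).
by near: h; exact: diff_eps.
Unshelve. all: by end_near. Qed.

Lemma diff_near (V W : normedModType R) (f g : V -> W) x :
  (\forall y \near x, f y = g y) -> differentiable f x -> 'd f x = 'd g x :> (V -> W).
Proof. by move=> fg df; exact: esym (differentiable_near fg df).2. Qed.

(** Unlike the differential itself, D is a mere function, so that differentials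
    computed by the rules below can be written as plain expressions. *)
Definition has_diff (V W : normedModType R) (f : V -> W) x (D : V -> W) :=
  differentiable f x /\ forall v, 'd f x v = D v.

Lemma has_diff_diff (V W : normedModType R) (f : V -> W) x :
  differentiable f x -> has_diff f x ('d f x).
Proof. by []. Qed.

Lemma has_diff_eq (V W : normedModType R) (f : V -> W) x D D' :
  has_diff f x D -> D =1 D' -> has_diff f x D'.
Proof. by move=> [? E] DD; split=> // v; rewrite E. Qed.

Lemma has_diff_near (V W : normedModType R) (f g : V -> W) x D :
  (\forall y \near x, f y = g y) -> has_diff f x D -> has_diff g x D.
Proof.
move=> fg [df Df]; have [dg Dg] := differentiable_near fg df; split=> // v.
exact: etrans (congr1 (fun h => h v) Dg) (Df v).
Qed.

Lemma has_diff_unique (V W : normedModType R) (f : V -> W) x D D' :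
  has_diff f x D -> has_diff f x D' -> D =1 D'.
Proof. by move=> [_ E] [_ E'] v; rewrite -E. Qed.

Lemma has_diff_cst (V W : normedModType R) (a : W) (x : V) :
  has_diff (fun _ : V => a) x (fun=> 0).
Proof.
split; first exact: (differentiable_cst a x).
by move=> v; rewrite (diff_cst a x).
Qed.

Lemma has_diff_linear (V W : normedModType R) (L : {linear V -> W}) x :
  continuous L -> has_diff L x L.
Proof.
move=> Lc; split; first exact: linear_differentiable.
by move=> v; rewrite diff_lin.
Qed.

Lemma has_diff_id (V : normedModType R) (x : V) : has_diff id x id.
Proof. exact: (@has_diff_linear V V idfun x (fun x => cvg_id)). Qed.

Lemma has_diff_fst (V W : normedModType R) (x : V * W) : has_diff fst x fst.
Proof. exact: (@has_diff_linear _ V fst x (fun x => cvg_fst)). Qed.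

Lemma has_diff_snd (V W : normedModType R) (x : V * W) : has_diff snd x snd.
Proof. exact: (@has_diff_linear _ W snd x (fun x => cvg_snd)). Qed.

Lemma diff_scalar (W : normedModType R) (f : R^o -> W) t (h : R) :
  'd f t h = h *: 'd f t 1.
Proof. by rewrite -[in LHS](mulr1 h); exact: (linearZ_LR ('d f t) h 1). Qed.

Lemma has_diff_comp (U V W : normedModType R) (f : U -> V) (g : V -> W) x Df Dg :
  has_diff f x Df -> has_diff g (f x) Dg ->
  has_diff (fun y => g (f y)) x (fun v => Dg (Df v)).
Proof.
move=> [df Ef] [dg Eg]; split; first exact: (@differentiable_comp _ _ _ _ f g).
move=> v; apply: etrans (congr1 (fun h => h v) (diff_comp df dg)) _.
exact: etrans (Eg _) (congr1 Dg (Ef v)).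
Qed.

Lemma has_diff_add (V W : normedModType R) (f g : V -> W) x Df Dg :
  has_diff f x Df -> has_diff g x Dg ->
  has_diff (fun y => f y + g y) x (fun v => Df v + Dg v).
Proof.
move=> [df Ef] [dg Eg]; split; first exact: differentiableD.
move=> v; apply: etrans (congr1 (fun h => h v) (diffD df dg)) _.
exact: congr2 (Ef v) (Eg v).
Qed.

Lemma has_diff_sub (V W : normedModType R) (f g : V -> W) x Df Dg :
  has_diff f x Df -> has_diff g x Dg ->
  has_diff (fun y => f y - g y) x (fun v => Df v - Dg v).
Proof.
move=> [df Ef] [dg Eg]; split; first exact: differentiableB.
move=> v; apply: etrans (congr1 (fun h => h v) (diffB df dg)) _.
exact: congr2 (Ef v) (congr1 _ (Eg v)).
Qed.

Fact scale_bilinear (W : normedModType R) :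
  bilinear_for
    (GRing.Scale.Law.clone _ _ *:%R _) (GRing.Scale.Law.clone _ _ *:%R _)
    (fun (a : R^o) (w : W) => a *: w).
Proof.
split=> [w|a] b y z /=; first by rewrite scalerDl scalerA.
by rewrite scalerDr !scalerA mulrC.
Qed.

Lemma is_diff_scale (V W : normedModType R) (c : V -> R^o) (f : V -> W) x :
  differentiable c x -> differentiable f x ->
  differentiable (fun y => c y *: f y) x /\
  forall v, 'd (fun y => c y *: f y) x v = c x *: 'd f x v + 'd c x v *: f x.
Proof.
move=> dc df.
pose sM := bilinear_isBilinear.Build R R^o W W _ _ _ (scale_bilinear W).
pose s : {bilinear R^o -> W -> W} := HB.pack (fun (a : R^o) (w : W) => a *: w) sM.
have sc : continuous (fun p : R^o * W => s p.1 p.2) by exact: scale_continuous.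
have dp := differentiable_pair dc df.
have ds := differentiable_bilin (c x, f x) sc.
have E : (fun y => c y *: f y) =
  (fun p : R^o * W => s p.1 p.2) \o (fun y => (c y, f y)) by [].
rewrite E; split; first exact: differentiable_comp.
move=> v; rewrite diff_comp//= diff_pair//.
by rewrite (diff_bilin (c x, f x) sc).
Qed.

Lemma has_diff_scale (V W : normedModType R) (c : V -> R^o) (f : V -> W) x Dc Df :
  has_diff c x Dc -> has_diff f x Df ->
  has_diff (fun y => c y *: f y) x (fun v => c x *: Df v + Dc v *: f x).
Proof.
move=> [dc Ec] [df Ef]; have [d E] := is_diff_scale dc df.
split=> // v; apply: etrans (E v) _.
exact: congr2 (congr1 _ (Ef v)) (congr1 (fun b => b *: f x) (Ec v)).
Qed.

Lemma has_diff_sum (V W : normedModType R) (I : Type) (r : seq I)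
    (f : I -> V -> W) x (D : I -> V -> W) :
  (forall i, has_diff (f i) x (D i)) ->
  has_diff (fun y => \sum_(i <- r) f i y) x (fun v => \sum_(i <- r) D i v).
Proof.
move=> H; elim: r => [|i r IH].
  have -> : (fun x => \sum_(i <- [::]) f i x) = (fun _ => 0).
    by apply/funext => y; rewrite big_nil.
  by apply: has_diff_eq (has_diff_cst _ _) _ => v; rewrite big_nil.
have -> : (fun x => \sum_(j <- i :: r) f j x) =
   (fun x => f i x + \sum_(j <- r) f j x).
  by apply/funext => y; rewrite big_cons.
by apply: has_diff_eq (has_diff_add (H i) IH) _ => v; rewrite big_cons.
Qed.

Lemma has_diff_mx (V : normedModType R) m n (M : V -> 'M[R]_(m, n)) x
    (D : V -> 'M[R]_(m, n)) :
  (forall i j, has_diff (fun y => M y i j : R^o) x (fun h => D h i j)) ->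
  has_diff M x D.
Proof.
move=> H; have -> : M = (fun y => \sum_i \sum_j M y i j *: delta_mx i j).
  by apply/funext => y; rewrite -matrix_sum_delta.
apply: has_diff_eq (has_diff_sum (index_enum _) (fun i => has_diff_sum (index_enum _)
  (fun j => has_diff_scale (H i j) (has_diff_cst (delta_mx i j) _)))) _.
move=> h; rewrite [RHS]matrix_sum_delta; apply: eq_bigr => i _; apply: eq_bigr => j _.
by rewrite scaler0 add0r.
Qed.

Lemma has_diff_pair (V W Z : normedModType R) (f : V -> W) (g : V -> Z) x Df Dg :
  has_diff f x Df -> has_diff g x Dg ->
  has_diff (fun y => (f y, g y)) x (fun v => (Df v, Dg v)).
Proof.
move=> [df Ef] [dg Eg]; split; first exact: differentiable_pair.
move=> v; apply: etrans (congr1 (fun h => h v) (diff_pair df dg)) _.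
exact: congr2 (Ef v) (Eg v).
Qed.

Lemma has_diff_pair_r (V W : normedModType R) (x : V) (y : W) :
  has_diff (fun w : W => (x, w)) y (fun h => (0, h)).
Proof. exact: has_diff_pair (has_diff_cst _ _) (has_diff_id _). Qed.

Lemma has_diff_shift (V W : normedModType R) (f : V -> W) x w :
  differentiable f (x + w) -> has_diff (fun y => f (y + w)) x ('d f (x + w)).
Proof.
move=> df; have H : has_diff (fun y => y + w) x id.
  apply: has_diff_eq (has_diff_add (has_diff_id x) (has_diff_cst w x)) _.
  by move=> v; rewrite addr0.
exact: has_diff_comp H (has_diff_diff df).
Qed.

Lemma has_diff_line (V : normedModType R) (x v : V) (t : R^o) :
  has_diff (fun s : R^o => x + s *: v) t (fun h => h *: v).
Proof.
apply: has_diff_eq (has_diff_add (has_diff_cst _ _)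
   (has_diff_scale (has_diff_id _) (has_diff_cst _ _))) _.
by move=> h /=; rewrite add0r scaler0 add0r.
Qed.

Lemma has_diff_derive1 (W : normedModType R) (f : R^o -> W) t D :
  has_diff f t D -> derivable f t 1 /\ derive1 f t = D 1.
Proof.
move=> [df E]; split; first exact: diff_derivable.
by rewrite derive1E deriveE // E.
Qed.

(** * Maps of class C^k *)

Definition linear_map (V W : lmodType R) (f : V -> W) (fl : linear f) :
  {linear V -> W} := HB.pack f (GRing.isLinear.Build _ _ _ _ _ fl).

(** Indexing the basis by an arbitrary finite type makes this class closed under
    products by taking the disjoint union of the index types. *)
Definition finite_dim (V : normedModType R) :=
  exists (I : finType) (e : I -> V) (l : I -> {linear V -> R^o}),
    (forall i, continuous (l i)) /\ forall v, v = \sum_i l i v *: e i.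

Lemma finite_dim_R : finite_dim R^o.
Proof.
exists unit, (fun=> 1), (fun=> idfun); split; first by move=> _ x; exact: cvg_id.
by move=> v; rewrite big_const cardT enumT unlock /= addr0 /= [RHS]mulr1.
Qed.

Lemma finite_dim_rV n : finite_dim 'rV[R]_n.
Proof.
have ll (i : 'I_n) : linear (fun v : 'rV[R]_n => v 0 i : R^o).
  by move=> a u v; rewrite !mxE.
exists 'I_n, (fun i => delta_mx 0 i), (fun i => linear_map (ll i)); split.
  by move=> i; exact: coord_continuous.
by move=> v; exact: row_sum_delta.
Qed.

Lemma finite_dim_prod (V W : normedModType R) :
  finite_dim V -> finite_dim W -> finite_dim (V * W)%type.
Proof.
move=> [I [e [l [lc le]]]] [J [f [m [mc me]]]].
pose g (i : I + J) := match i with inl i => (e i, 0) | inr j => (0, f j) end.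
pose h (i : I + J) : V * W -> R^o :=
  match i with inl i => l i \o fst | inr j => m j \o snd end.
have hl i : linear (h i).
  by case: i => i a u v /=; rewrite linearP.
exists (I + J)%type, g, (fun i => linear_map (hl i)); split.
  case=> i x /=.
    apply: (@continuous_comp _ _ _ fst (l i)); [exact: cvg_fst|exact: lc].
  apply: (@continuous_comp _ _ _ snd (m i)); [exact: cvg_snd|exact: mc].
move=> [v w]; rewrite big_sumType /=.
have -> : \sum_i l i v *: (e i, 0 : W) = (\sum_i l i v *: e i, 0).
  by elim/big_rec2: _ => // i y1 y2 _ ->; congr pair => /=; rewrite scaler0 addr0.
have -> : \sum_i m i w *: (0 : V, f i) = (0, \sum_i m i w *: f i).
  by elim/big_rec2: _ => // i y1 y2 _ ->; congr pair => /=; rewrite scaler0 addr0.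
by rewrite -le -me; congr pair; rewrite /= ?addr0 ?add0r.
Qed.

Lemma Ck_congr k (V W : normedModType R) (U : set V) (f g : V -> W) :
  open U -> (forall x, U x -> f x = g x) -> Ck_on k U f -> Ck_on k U g.
Proof.
move=> oU; have nU x : U x -> \forall y \near x, U y.
  by move=> Ux; exact: open_nbhs_nbhs.
elim: k f g => [|k IH] f g fg /=.
  move=> Cf x Ux; have := Cf x Ux; rewrite /prop_for /continuous_at -fg//.
  apply: cvg_trans; apply: near_eq_cvg.
  by apply: filterS (nU x Ux) => y /fg.
have fgx x : U x -> \forall y \near x, f y = g y.
  by move=> Ux; apply: filterS (nU x Ux) => y /fg.
move=> [df Cf]; split=> [x Ux|v].
  by have [] := differentiable_near (fgx x Ux) (df x Ux).
apply: IH (Cf v) => x Ux; rewrite (diff_near (fgx x Ux))//; exact: df.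
Qed.

Lemma Ck_subset k (V W : normedModType R) (U U' : set V) (f : V -> W) :
  U' `<=` U -> Ck_on k U f -> Ck_on k U' f.
Proof.
move=> UU; elim: k f => [|k IH] f /=; first by move=> Cf x /UU; exact: Cf.
by move=> [df Cf]; split=> [x /UU/df//|v]; exact: IH.
Qed.

Lemma Ck_pred k (V W : normedModType R) (U : set V) (f : V -> W) :
  Ck_on k.+1 U f -> Ck_on k U f.
Proof.
elim: k f => [|k IH] f /=; first by move=> [df _] x /df; exact: differentiable_continuous.
by move=> [df Cf]; split=> // v; apply: IH; exact: Cf.
Qed.

Lemma Ck_cst k (V W : normedModType R) (U : set V) (a : W) :
  Ck_on k U (fun _ : V => a).
Proof.
elim: k a => [|k IH] a /=; first by move=> x _; exact: cvg_cst.
split=> [x _|v]; first exact: (differentiable_cst a x).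
have -> : (fun x => 'd (fun _ : V => a) x v) = (fun _ => 0).
  by apply/funext => x; rewrite (diff_cst a x).
exact: IH.
Qed.

Lemma Ck_linear k (V W : normedModType R) (U : set V) (L : {linear V -> W}) :
  continuous L -> Ck_on k U L.
Proof.
move=> Lc; case: k => [|k] /=; first by move=> x _; exact: Lc.
split=> [x _|v]; first exact: linear_differentiable.
have -> : (fun x => 'd L x v) = (fun _ => L v).
  by apply/funext => x; rewrite diff_lin.
exact: Ck_cst.
Qed.

Lemma Ck_linear_comp k (V W Z : normedModType R) (U : set V) (f : V -> W)
    (L : {linear W -> Z}) : open U -> continuous L ->
  Ck_on k U f -> Ck_on k U (fun x => L (f x)).
Proof.
move=> oU Lc; elim: k f => [|k IH] f.
  by move=> Cf x Ux; apply: (@continuous_comp _ _ _ f L); [exact: Cf|exact: Lc].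
move=> [df Cf]; have dL w := linear_differentiable w Lc; split=> [x Ux|v].
  by apply: (@differentiable_comp _ _ _ _ f L); [exact: df|exact: dL].
apply: (Ck_congr oU) (IH _ (Cf v)) => x Ux.
apply: etrans (esym (congr1 (fun h => h v) (diff_comp (df x Ux) (dL (f x))))).
by rewrite /= diff_lin.
Qed.

Lemma Ck_add k (V W : normedModType R) (U : set V) (f g : V -> W) : open U ->
  Ck_on k U f -> Ck_on k U g -> Ck_on k U (fun x => f x + g x).
Proof.
move=> oU; elim: k f g => [|k IH] f g /=.
  by move=> Cf Cg x Ux; apply: cvgD; [exact: Cf|exact: Cg].
move=> [df Cf] [dg Cg]; split=> [x Ux|v].
  by apply: differentiableD; [exact: df|exact: dg].
apply: (Ck_congr oU) (IH _ _ (Cf v) (Cg v)) => x Ux.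
exact: esym (congr1 (fun h => h v) (diffD (df x Ux) (dg x Ux))).
Qed.

Lemma Ck_sum k (V W : normedModType R) (U : set V) (I : Type) (r : seq I)
  (P : pred I) (f : I -> V -> W) : open U ->
  (forall i, Ck_on k U (f i)) -> Ck_on k U (fun x => \sum_(i <- r | P i) f i x).
Proof.
move=> oU Cf; elim: r => [|i r IH].
  have -> : (fun x => \sum_(i <- [::] | P i) f i x) = (fun _ => 0).
    by apply/funext => x; rewrite big_nil.
  exact: Ck_cst.
have -> : (fun x => \sum_(j <- i :: r | P j) f j x) =
   if P i then (fun x => f i x + \sum_(j <- r | P j) f j x)
   else (fun x => \sum_(j <- r | P j) f j x).
  by apply/funext => x; rewrite big_cons; case: (P i).
by case: (P i) => //; exact: Ck_add.
Qed.

Lemma Ck_scale k (V W : normedModType R) (U : set V) (c : V -> R^o) (f : V -> W) :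
  open U -> Ck_on k U c -> Ck_on k U f -> Ck_on k U (fun x => c x *: f x).
Proof.
move=> oU; elim: k c f => [|k IH] c f.
  move=> Cc Cf x Ux; apply: (@cvgZ _ _ _ _ _ c f); [exact: Cc|exact: Cf].
move=> Cc' Cf'; have Cc0 := Ck_pred Cc'; have Cf0 := Ck_pred Cf'.
case: Cc' Cf' => [dc Cc] [df Cf].
split=> [x Ux|v].
  by have [] := is_diff_scale (dc x Ux) (df x Ux).
apply: (Ck_congr oU) (Ck_add oU (IH _ _ Cc0 (Cf v)) (IH _ _ (Cc v) Cf0)) => x Ux /=.
by have [_ E] := is_diff_scale (dc x Ux) (df x Ux); exact: esym (E v).
Qed.

Lemma Ck_mul k (V : normedModType R) (U : set V) (c f : V -> R^o) :
  open U -> Ck_on k U c -> Ck_on k U f -> Ck_on k U (fun x => c x * f x : R^o).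
Proof. exact: Ck_scale. Qed.

Lemma Ck_opp k (V W : normedModType R) (U : set V) (f : V -> W) : open U ->
  Ck_on k U f -> Ck_on k U (fun x => - f x).
Proof.
move=> oU Cf; apply: (Ck_congr oU) (Ck_scale oU (Ck_cst k U (-1 : R^o)) Cf).
by move=> x _; rewrite scaleN1r.
Qed.

Lemma Ck_sub k (V W : normedModType R) (U : set V) (f g : V -> W) : open U ->
  Ck_on k U f -> Ck_on k U g -> Ck_on k U (fun x => f x - g x).
Proof. by move=> oU Cf Cg; apply: Ck_add => //; exact: Ck_opp. Qed.

Lemma Ck_prod k (V : normedModType R) (U : set V) (I : Type) (r : seq I)
  (P : pred I) (f : I -> V -> R^o) : open U ->
  (forall i, Ck_on k U (f i)) ->
  Ck_on k U (fun x => \prod_(i <- r | P i) f i x : R^o).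
Proof.
move=> oU Cf; elim: r => [|i r IH].
  have -> : (fun x => \prod_(i <- [::] | P i) f i x) = (fun _ => 1).
    by apply/funext => x; rewrite big_nil.
  exact: Ck_cst.
have -> : (fun x => \prod_(j <- i :: r | P j) f j x) =
   if P i then (fun x => f i x * \prod_(j <- r | P j) f j x)
   else (fun x => \prod_(j <- r | P j) f j x).
  by apply/funext => x; rewrite big_cons; case: (P i).
by case: (P i) => //; exact: Ck_mul.
Qed.

Lemma Ck_inv k (V : normedModType R) (U : set V) (f : V -> R^o) : open U ->
  (forall x, U x -> f x != 0) ->
  Ck_on k U f -> Ck_on k U (fun x => (f x)^-1 : R^o).
Proof.
move=> oU f0; elim: k => [|k IH].
  by move=> Cf x Ux; apply: cvgV; [exact: f0|exact: Cf].
move=> Cf'; have := IH (Ck_pred Cf') => Ci; case: Cf' => [df Cf].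
split=> [x Ux|v].
  by apply: differentiableV; [exact: df|exact: f0].
apply: (Ck_congr oU) (Ck_mul oU (Ck_opp oU (Ck_mul oU Ci Ci)) (Cf v)) => x Ux.
apply: etrans (esym (congr1 (fun h => h v) (diffV (df x Ux) (f0 x Ux)))).
by rewrite /= -expr2 exprVn.
Qed.

Lemma Ck_pair k (V W Z : normedModType R) (U : set V) (f : V -> W) (g : V -> Z) :
  open U -> Ck_on k U f -> Ck_on k U g -> Ck_on k U (fun x => (f x, g x)).
Proof.
move=> oU; elim: k f g => [|k IH] f g /=.
  by move=> Cf Cg x Ux; apply: cvg_pair; [exact: Cf|exact: Cg].
move=> [df Cf] [dg Cg]; split=> [x Ux|v].
  by apply: differentiable_pair; [exact: df|exact: dg].
apply: (Ck_congr oU) (IH _ _ (Cf v) (Cg v)) => x Ux.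
exact: esym (congr1 (fun h => h v) (diff_pair (df x Ux) (dg x Ux))).
Qed.

(** In the differential of a composite, 'd g (f x) is applied to a vector that
    moves with x, whereas [Ck_on] only speaks of fixed vectors.  Expanding the
    moving vector along a basis reduces the former to the latter. *)
Lemma Ck_comp k (V W Z : normedModType R) (U : set V) (U' : set W)
    (f : V -> W) (g : W -> Z) :
  finite_dim W -> open U -> open U' -> (forall x, U x -> U' (f x)) ->
  Ck_on k U f -> Ck_on k U' g -> Ck_on k U (fun x => g (f x)).
Proof.
move=> [I [e [l [lc le]]]] oU oU' fU; elim: k g f fU => [|k IH] g f fU.
  move=> Cf Cg x Ux; apply: (@continuous_comp _ _ _ f g); [exact: Cf|].
  by apply: Cg; exact: fU.
move=> Cf' [dg Cg]; have Cf0 := Ck_pred Cf'; case: Cf' => [df Cf].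
split=> [x Ux|v].
  by apply: (@differentiable_comp _ _ _ _ f g); [exact: df|apply: dg; exact: fU].
have H : Ck_on k U (fun x => \sum_i (l i ('d f x v)) *: 'd g (f x) (e i)).
  apply: Ck_sum => // i; apply: Ck_scale => //.
    by apply: Ck_linear_comp => //; exact: Cf.
  by apply: (IH (fun y => 'd g y (e i)) f) => //; exact: Cg.
apply: (Ck_congr oU) H => x Ux.
apply: etrans (esym (congr1 (fun h => h v) (diff_comp (df x Ux) (dg _ (fU x Ux))))).
by rewrite [X in _ = 'd g (f x) X]le linear_sum; apply: eq_bigr => i _; rewrite linearZ.
Qed.

Lemma coord_linear m n (i : 'I_m) (j : 'I_n) :
  linear (fun M : 'M[R]_(m, n) => M i j : R^o).
Proof. by move=> a u v; rewrite !mxE. Qed.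

Lemma Ck_coord k (V : normedModType R) (U : set V) m n (M : V -> 'M[R]_(m, n)) i j :
  open U -> Ck_on k U M -> Ck_on k U (fun x => M x i j : R^o).
Proof.
move=> oU CM; apply: (@Ck_linear_comp _ _ _ _ U M (linear_map (coord_linear i j))) => //.
exact: coord_continuous.
Qed.

Lemma Ck_mx k (V : normedModType R) (U : set V) m n (M : V -> 'M[R]_(m, n)) :
  open U -> (forall i j, Ck_on k U (fun x => M x i j : R^o)) -> Ck_on k U M.
Proof.
move=> oU CM.
have -> : M = (fun x => \sum_i \sum_j M x i j *: delta_mx i j).
  by apply/funext => x; rewrite -matrix_sum_delta.
apply: Ck_sum => // i; apply: Ck_sum => // j; apply: Ck_scale => //.
exact: Ck_cst.
Qed.

Lemma Ck_det k (V : normedModType R) (U : set V) n (M : V -> 'M[R]_n) :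
  open U -> (forall i j, Ck_on k U (fun x => M x i j : R^o)) ->
  Ck_on k U (fun x => \det (M x) : R^o).
Proof.
move=> oU CM; apply: Ck_sum => // s; apply: Ck_mul => //; first exact: Ck_cst.
by apply: Ck_prod.
Qed.

(** Cramer's rule: the inverse is a rational expression in the entries. *)
Lemma Ck_invmx k (V : normedModType R) (U : set V) n (M : V -> 'M[R]_n) :
  open U -> (forall x, U x -> M x \in unitmx) ->
  Ck_on k U M -> Ck_on k U (fun x => invmx (M x)).
Proof.
move=> oU uM CM; have CMij i j := Ck_coord i j oU CM.
suff H : Ck_on k U (fun x => (\det (M x))^-1 *: \adj (M x)).
  by apply: (Ck_congr oU) H => x Ux; rewrite /invmx uM.
apply: (@Ck_scale _ _ _ _ (fun x => (\det (M x))^-1)) => //.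
  apply: Ck_inv => //; last exact: Ck_det.
  by move=> x Ux; rewrite -unitfE -[_ \is a _]/(M x \in unitmx); exact: uM.
apply: Ck_mx => // i j.
have -> : (fun x => (\adj (M x)) i j : R^o) = (fun x => cofactor (M x) j i).
  by apply/funext => x; rewrite mxE.
apply: Ck_mul => //; first exact: Ck_cst.
apply: Ck_det => // i' j'.
have -> : (fun x => (row' j (col' i (M x))) i' j' : R^o) =
   (fun x => M x (lift j i') (lift i j')).
  by apply/funext => x; rewrite !mxE.
exact: CMij.
Qed.

Lemma Ck_mulmx k (V : normedModType R) (U : set V) m n p (M : V -> 'M[R]_(m, n))
  (N : V -> 'M[R]_(n, p)) : open U ->
  Ck_on k U M -> Ck_on k U N -> Ck_on k U (fun x => M x *m N x).
Proof.
move=> oU CM CN; apply: Ck_mx => // i j.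
have -> : (fun x => (M x *m N x) i j : R^o) = (fun x => \sum_l M x i l * N x l j).
  by apply/funext => x; rewrite mxE.
apply: Ck_sum => // l; apply: Ck_mul => //; exact: Ck_coord.
Qed.

Lemma finite_dim_continuous (V W : normedModType R) (L : {linear V -> W}) :
  finite_dim V -> continuous L.
Proof.
move=> [I [e [l [lc le]]]].
have -> : (L : V -> W) = (fun v => \sum_i l i v *: L (e i)).
  apply/funext => v; rewrite [in LHS](le v) linear_sum.
  by apply: eq_bigr => i _; rewrite linearZ.
suff : Ck_on 0 setT (fun v => \sum_i l i v *: L (e i)) by move=> C v; exact: C.
apply: Ck_sum => [|i]; first exact: openT.
by apply: Ck_scale; [exact: openT|exact: Ck_linear|exact: Ck_cst].
Qed.

(** * Smooth maps *)

(** The product rule for the pairing of 'd f (c q) with a moving vector w q.  A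
    basis turns the pairing into a finite sum of scalars times vectors. *)
Lemma has_diff_apply (U V W : normedModType R) (f : V -> W) (c w : U -> V)
    (p : U) Dc Dw :
  finite_dim V -> has_diff c p Dc -> has_diff w p Dw ->
  (forall v, differentiable (fun y => 'd f y v) (c p)) ->
  has_diff (fun q => 'd f (c q) (w q)) p
    (fun h => 'd (fun y => 'd f y (w p)) (c p) (Dc h) + 'd f (c p) (Dw h)).
Proof.
move=> [I [e [l [lc le]]]] hc hw df.
have E y v : 'd f y v = \sum_i l i v *: 'd f y (e i).
  by rewrite [in LHS](le v) linear_sum; apply: eq_bigr => i _; rewrite linearZ.
have -> : (fun q => 'd f (c q) (w q)) =
   (fun q => \sum_i l i (w q) *: 'd f (c q) (e i)).
  by apply/funext => q; rewrite E.
have H i : has_diff (fun q => l i (w q) *: 'd f (c q) (e i)) p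
   (fun h => l i (w p) *: 'd (fun y => 'd f y (e i)) (c p) (Dc h) +
      l i (Dw h) *: 'd f (c p) (e i)).
  apply: has_diff_scale; first exact: has_diff_comp hw (has_diff_linear _ (lc i)).
  exact: has_diff_comp hc (has_diff_diff (df (e i))).
apply: has_diff_eq (has_diff_sum _ H) _ => h; rewrite big_split /= -E.
congr (_ + _); symmetry.
have : has_diff (fun y => 'd f y (w p)) (c p)
    (fun h => \sum_i l i (w p) *: 'd (fun y => 'd f y (e i)) (c p) h).
  have -> : (fun y => 'd f y (w p)) =
     (fun y => \sum_i l i (w p) *: 'd f y (e i)).
    by apply/funext => q; rewrite E.
  apply: has_diff_sum => i.
  apply: has_diff_eq (has_diff_scale (has_diff_cst _ _) (has_diff_diff (df (e i)))) _.
  by move=> v /=; rewrite scale0r addr0.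
by move=> [_ ->].
Qed.

(** The same rule when the values c0 and w0 at p are known in another form than
    c p and w p. *)
Lemma has_diff_apply_at (U V W : normedModType R) (f : V -> W) (c w : U -> V)
    (p : U) c0 w0 Dc Dw :
  finite_dim V -> c p = c0 -> w p = w0 -> has_diff c p Dc -> has_diff w p Dw ->
  (forall v, differentiable (fun y => 'd f y v) c0) ->
  has_diff (fun q => 'd f (c q) (w q)) p
    (fun h => 'd (fun y => 'd f y w0) c0 (Dc h) + 'd f c0 (Dw h)).
Proof. by move=> fV <- <-; exact: has_diff_apply. Qed.

Lemma smooth_congr (V W : normedModType R) (U : set V) (f g : V -> W) :
  open U -> (forall x, U x -> f x = g x) -> smooth_on U f -> smooth_on U g.
Proof. by move=> oU fg sf k; apply: Ck_congr oU fg _. Qed.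

Lemma smooth_subset (V W : normedModType R) (U U' : set V) (f : V -> W) :
  U' `<=` U -> smooth_on U f -> smooth_on U' f.
Proof. by move=> UU sf k; apply: Ck_subset UU _. Qed.

Lemma smooth_cst (V W : normedModType R) (U : set V) (a : W) :
  smooth_on U (fun _ : V => a).
Proof. by move=> k; exact: Ck_cst. Qed.

Lemma smooth_linear (V W : normedModType R) (U : set V) (L : {linear V -> W}) :
  continuous L -> smooth_on U L.
Proof. by move=> Lc k; exact: Ck_linear. Qed.

Lemma smooth_fst (V W : normedModType R) (U : set (V * W)) : smooth_on U fst.
Proof. exact: (@smooth_linear _ V U fst (fun x => cvg_fst)). Qed.

Lemma smooth_snd (V W : normedModType R) (U : set (V * W)) : smooth_on U snd.
Proof. exact: (@smooth_linear _ W U snd (fun x => cvg_snd)). Qed.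

Lemma smooth_id (V : normedModType R) (U : set V) : smooth_on U id.
Proof. exact: (@smooth_linear _ V U idfun (fun x => cvg_id)). Qed.

Lemma smooth_linear_comp (V W Z : normedModType R) (U : set V) (f : V -> W)
    (L : {linear W -> Z}) : open U -> continuous L ->
  smooth_on U f -> smooth_on U (fun x => L (f x)).
Proof. by move=> oU Lc sf k; exact: Ck_linear_comp. Qed.

Lemma smooth_sub (V W : normedModType R) (U : set V) (f g : V -> W) : open U ->
  smooth_on U f -> smooth_on U g -> smooth_on U (fun x => f x - g x).
Proof. by move=> oU sf sg k; exact: Ck_sub. Qed.

Lemma smooth_sum (V W : normedModType R) (U : set V) (I : Type) (r : seq I)
  (f : I -> V -> W) : open U ->
  (forall i, smooth_on U (f i)) -> smooth_on U (fun x => \sum_(i <- r) f i x).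
Proof. by move=> oU sf k; apply: Ck_sum => // i; exact: sf. Qed.

Lemma smooth_scale (V W : normedModType R) (U : set V) (c : V -> R^o) (f : V -> W) :
  open U -> smooth_on U c -> smooth_on U f -> smooth_on U (fun x => c x *: f x).
Proof. by move=> oU sc sf k; exact: Ck_scale. Qed.

Lemma smooth_pair (V W Z : normedModType R) (U : set V) (f : V -> W) (g : V -> Z) :
  open U -> smooth_on U f -> smooth_on U g -> smooth_on U (fun x => (f x, g x)).
Proof. by move=> oU sf sg k; exact: Ck_pair. Qed.

Lemma smooth_comp (V W Z : normedModType R) (U : set V) (U' : set W)
    (f : V -> W) (g : W -> Z) :
  finite_dim W -> open U -> open U' -> (forall x, U x -> U' (f x)) ->
  smooth_on U f -> smooth_on U' g -> smooth_on U (fun x => g (f x)).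
Proof. by move=> fW oU oU' fU sf sg k; apply: Ck_comp oU' fU _ _. Qed.

Lemma smooth_differentiable (V W : normedModType R) (U : set V) (f : V -> W) x :
  smooth_on U f -> U x -> differentiable f x.
Proof. by move=> sf; have [+ _] := sf 1%N; exact. Qed.

Lemma smooth_continuous (V W : normedModType R) (U : set V) (f : V -> W) x :
  smooth_on U f -> U x -> {for x, continuous f}.
Proof. by move=> sf; exact: (sf 0%N). Qed.

Lemma smooth_diff (V W : normedModType R) (U : set V) (f : V -> W) v :
  smooth_on U f -> smooth_on U (fun x => 'd f x v).
Proof. by move=> sf k; have [_] := sf k.+1; exact. Qed.

Lemma smooth_diff_apply (V W : normedModType R) (U : set V) (f : V -> W)
    (w : V -> V) : finite_dim V -> open U ->
  smooth_on U f -> smooth_on U w -> smooth_on U (fun x => 'd f x (w x)).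
Proof.
move=> [I [e [l [lc le]]]] oU sf sw.
have -> : (fun x => 'd f x (w x)) = (fun x => \sum_i l i (w x) *: 'd f x (e i)).
  apply/funext => x; rewrite [in LHS](le (w x)) linear_sum.
  by apply: eq_bigr => i _; rewrite linearZ.
apply: smooth_sum => // i; apply: smooth_scale => //.
  exact: smooth_linear_comp.
exact: smooth_diff.
Qed.

Lemma smooth_mx (V : normedModType R) (U : set V) m n (M : V -> 'M[R]_(m, n)) :
  open U -> (forall i j, smooth_on U (fun x => M x i j : R^o)) -> smooth_on U M.
Proof. by move=> oU sM k; apply: Ck_mx => // i j; exact: sM. Qed.

(** * Symmetry of second derivatives *)

Lemma mean_value_line (V : normedModType R) (f : V -> R^o) x v :
  (forall t : R, 0 <= t <= 1 -> differentiable f (x + t *: v)) ->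
  exists2 c : R, 0 <= c <= 1 & f (x + v) - f x = 'd f (x + c *: v) v.
Proof.
move=> df; pose g (t : R) : R := f (x + t *: v).
have Hg (t : R) : 0 <= t <= 1 -> has_diff (g : R^o -> R^o) t
    (fun h => 'd f (x + t *: v) (h *: v)).
  move=> t01; exact: has_diff_comp (has_diff_line x v t) (has_diff_diff (df t t01)).
have [] := @MVT_segment R g (fun t => 'd f (x + t *: v) v) 0 1 ler01.
- move=> t; rewrite in_itv /= => /andP[t0 t1].
  have [|D E] := has_diff_derive1 (Hg t _); first by rewrite !ltW.
  by apply: DeriveDef => //; rewrite -derive1E E scale1r.
- apply: continuous_in_subspaceT => t; rewrite inE /= in_itv /= => t01.
  exact: (differentiable_continuous (Hg t t01).1).
move=> c; rewrite in_itv /= => c01; rewrite /g scale1r scale0r addr0 subr0 mulr1 => E.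
by exists c.
Qed.

(** Mean value theorem in the direction v for y |-> f (y + w) - f y, then in the
    direction w for the derivative of f along v. *)
Lemma second_difference (V : normedModType R) (U : set V) (f : V -> R^o) x v w :
  open U -> Ck_on 2 U f ->
  (forall a b : R, 0 <= a <= 1 -> 0 <= b <= 1 -> U (x + a *: v + b *: w)) ->
  exists2 y, (exists a b : R, [/\ 0 <= a <= 1, 0 <= b <= 1 & y = x + a *: v + b *: w])
    & f (x + v + w) - f (x + v) - (f (x + w) - f x)
      = 'd (fun y => 'd f y v) y w.
Proof.
move=> oU [df Cf] Uxy.
have H0 : (0 : R) <= (0 : R) <= (1 : R) by apply/andP; split; [exact: lexx|exact: ler01].
have H1 : (0 : R) <= (1 : R) <= (1 : R) by apply/andP; split; [exact: ler01|exact: lexx].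
have Hd (t : R) : 0 <= t <= 1 -> has_diff (fun y => f (y + w) + (-1) *: f y)
    (x + t *: v) (fun h => 'd f (x + t *: v + w) h + (-1) *: 'd f (x + t *: v) h).
  move=> t01; apply: has_diff_add.
    by apply: has_diff_shift; apply: df; have := Uxy t 1 t01 H1; rewrite scale1r.
  apply: has_diff_eq (has_diff_scale (has_diff_cst (-1 : R^o) _)
    (has_diff_diff (df _ _))) _; last by move=> h; rewrite /= scale0r addr0.
  by have := Uxy t 0 t01 H0; rewrite scale0r addr0.
have [t t01|a a01] := @mean_value_line V (fun y => f (y + w) + (-1) *: f y) x v.
  exact: (Hd t t01).1.
rewrite (Hd a a01).2 !scaleN1r => ->.
have [t t01|b b01 ->] := @mean_value_line V (fun y => 'd f y v) (x + a *: v) w.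
  have [+ _] := Cf v; apply; exact: Uxy.
by exists (x + a *: v + b *: w) => //; exists a, b.
Qed.

(** The second difference of f is symmetric in its two increments.  With
    increments h v and h w it equals h^2 times either mixed derivative, each taken
    at some point of the parallelogram that they span; both points tend to x with
    h. *)
Lemma diff_sym_scalar (V : normedModType R) (U : set V) (f : V -> R^o) x v w :
  open U -> U x -> Ck_on 2 U f ->
  'd (fun y => 'd f y v) x w = 'd (fun y => 'd f y w) x v.
Proof.
move=> oU Ux Cf; have [df Cdf] := Cf.
pose P y := 'd (fun y => 'd f y v) y w; pose Q y := 'd (fun y => 'd f y w) y v.
have cP : P @ x --> P x by have [_ /(_ w)] := Cdf v; exact.
have cQ : Q @ x --> Q x by have [_ /(_ v)] := Cdf w; exact.
rewrite -/(P x) -/(Q x); apply/eqP; rewrite -subr_eq0 -normr_le0.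
apply/ler_addgt0Pl => e e0; rewrite addr0.
have e2 : 0 < e / 2 by rewrite divr_gt0.
have : \forall y \near x, [/\ U y, `|P x - P y| < e / 2 & `|Q x - Q y| < e / 2].
  near=> y; split; near: y; first exact: open_nbhs_nbhs.
    by move/cvgrPdist_lt : cP; exact.
  by move/cvgrPdist_lt : cQ; exact.
move=> /nbhs_ballP[d /= d0 xd].
pose h := d / (`|v| + `|w| + 1).
have n0 : 0 < `|v| + `|w| + 1 by rewrite ltr_wpDl// addr_ge0.
have h0 : 0 < h by rewrite divr_gt0.
have inB (a b : R) : 0 <= a <= 1 -> 0 <= b <= 1 ->
   ball x d (x + a *: (h *: v) + b *: (h *: w)).
  move=> /andP[a0 a1] /andP[b0 b1].
  rewrite -ball_normE /= -addrA opprD addNKr normrN.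
  apply: le_lt_trans (ler_normD _ _) _; rewrite !normrZ !ger0_norm ?(ltW h0)//.
  apply: (@le_lt_trans _ _ (h * `|v| + h * `|w|)).
    by apply: lerD; rewrite ler_piMl// mulr_ge0// ltW.
  by rewrite -mulrDr /h -mulrAC ltr_pdivrMr// ltr_pM2l// ltrDl.
  exact: ltW.
have oB : open (ball x d) by exact: ball_open.
have Cd k : Ck_on k U f -> Ck_on k (ball x d) f.
  by apply: Ck_subset => y /xd[].
have [y [a [b [a01 b01 ey]]] Ey] :=
  @second_difference V (ball x d) f x (h *: v) (h *: w) oB (Cd _ Cf) inB.
have [|z [a' [b' [a01' b01' ez]]] Ez] :=
  @second_difference V (ball x d) f x (h *: w) (h *: v) oB (Cd _ Cf).
  by move=> r s r01 s01; rewrite addrAC; exact: inB.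
have By : ball x d y by rewrite ey; exact: inB.
have Bz : ball x d z by rewrite ez addrAC; exact: inB.
have hh v' w' y' : ball x d y' -> 'd (fun y => 'd f y (h *: v')) y' (h *: w') =
   h * (h * 'd (fun y => 'd f y v') y' w').
  move=> /xd[Uy' _ _]; rewrite linearZ /=; congr (_ * _).
  have -> : (fun y => 'd f y (h *: v')) = (fun y => (h : R^o) *: 'd f y v').
    by apply/funext => ?; rewrite linearZ.
  have [_ ->] := has_diff_scale (has_diff_cst (h : R^o) y')
    (has_diff_diff ((Cdf v').1 y' Uy')).
  by rewrite scale0r addr0.
have PQ : P y = Q z.
  apply: (mulfI (lt0r_neq0 h0)); apply: (mulfI (lt0r_neq0 h0)).
  rewrite /P /Q -!hh// -Ey -Ez.
  rewrite [x + h *: w + h *: v]addrAC !opprB addrACA [RHS]addrACA.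
  by congr (_ + _); exact: addrC.
have [_ Py _] := xd _ By; have [_ _ Qz] := xd _ Bz.
have -> : P x - Q x = (P x - P y) - (Q x - Q z).
  by rewrite PQ opprB addrA subrK.
by rewrite (splitr e) (le_trans (ler_normB _ _))// lerD// ltW.
Unshelve. all: by end_near. Qed.

Lemma diff_sym (V W : normedModType R) (U : set V) (f : V -> W) x v w :
  finite_dim W -> open U -> U x -> smooth_on U f ->
  'd (fun y => 'd f y v) x w = 'd (fun y => 'd f y w) x v.
Proof.
move=> [I [e [l [lc le]]]] oU Ux sf.
rewrite [LHS]le [RHS]le; apply: eq_bigr => i _; congr (_ *: _).
have E a b : l i ('d (fun y => 'd f y a) x b) =
             'd (fun y => 'd (fun y => l i (f y)) y a) x b.
  have H : has_diff (fun y => l i ('d f y a)) x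
     (fun b => l i ('d (fun y => 'd f y a) x b)).
    apply: has_diff_comp (has_diff_linear _ (lc i)).
    apply: has_diff_diff; exact: smooth_differentiable (smooth_diff a sf) Ux.
  suff /(_ H)[_ ->// ] : has_diff (fun y => l i ('d f y a)) x
     (fun b => l i ('d (fun y => 'd f y a) x b)) ->
     has_diff (fun y => 'd (fun y => l i (f y)) y a) x
     (fun b => l i ('d (fun y => 'd f y a) x b)).
  apply: has_diff_near; apply: filterS (open_nbhs_nbhs (conj oU Ux)) => y Uy.
  have [_ ->//] := has_diff_comp (has_diff_diff (smooth_differentiable sf Uy))
    (has_diff_linear _ (lc i)).
rewrite !E; apply: (@diff_sym_scalar V U (fun y => l i (f y)) x v w oU Ux).
exact: (smooth_linear_comp oU (lc i) sf 2%N).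
Qed.

End Calculus.

(** * An implicit function theorem for curves *)

HB.instance Definition _ (R : realType) (m n : nat) := Complete.on 'M[R]_(m, n).

Section ImplicitCurve.
Context {R : realType}.

Lemma half_contraction_fixpoint (V : completeNormedModType R) (r : R) (f : V -> V) :
  0 <= r -> (forall x, `|x| <= r -> `|f x| <= r) ->
  (forall x y, `|x| <= r -> `|y| <= r -> `|f x - f y| <= 2^-1 * `|x - y|) ->
  exists2 x, `|x| <= r & x = f x.
Proof.
move=> r0 fr fc; pose U := [set x : V | `|x| <= r].
have fU : set_fun U U f by move=> x; exact: fr.
have [|||x Ux E] := @banach_fixed_point R V U (mkfun_fun fU).
- have h0 : (0 : R) <= 2^-1 by rewrite invr_ge0.
  exists (NngNum h0); split; first by rewrite /= invf_lt1// ltr1n.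
  by move=> [x y] [Ux Uy]; exact: fc.
- have -> : U = closed_ball_ (@Num.norm _ V) 0 r.
    by apply/seteqP; split=> x; rewrite /U /closed_ball_ /= sub0r normrN.
  exact: closed_closed_ball_.
- by exists 0; rewrite /U /= normr0.
by exists x.
Qed.

Lemma open_norm_lt (eps : R) : open [set t : R^o | `|t| < eps].
Proof.
have -> : [set t : R^o | `|t| < eps] = ball (0 : R^o) eps; last by exact: ball_open.
by apply/seteqP; split=> t; rewrite -ball_normE /= sub0r normrN.
Qed.

Lemma mx_entry_le m n (M : 'M[R]_(m, n)) i j : `|M i j| <= `|M|.
Proof.
rewrite [leRHS]/Num.Def.normr/= mx_normrE.
exact: (le_bigmax _ (fun ij => `|M ij.1 ij.2|) (i, j)).
Qed.

Lemma mx_norm_le m n (M : 'M[R]_(m, n)) (c : R) :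
  0 <= c -> (forall i j, `|M i j| <= c) -> `|M| <= c.
Proof.
move=> c0 Mc; rewrite [leLHS]/Num.Def.normr/= mx_normrE.
by apply: bigmax_le => // ij _; exact: Mc.
Qed.

Lemma mulmx_norm k n (x : 'rV[R]_k) (M : 'M[R]_(k, n)) :
  `|x *m M| <= k%:R * `|M| * `|x|.
Proof.
apply: mx_norm_le => [|i j]; first by rewrite !mulr_ge0.
rewrite mxE; apply: le_trans (ler_norm_sum _ _ _) _.
apply: (@le_trans _ _ (\sum_(l < k) `|M| * `|x|)).
  by apply: ler_sum => l _; rewrite normrM mulrC ler_pM// mx_entry_le.
by rewrite sumr_const card_ord -[leLHS]mulr_natl mulrA.
Qed.

Lemma near_unitmx k (V : normedModType R) (U : set V) (M : V -> 'M[R]_k) x :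
  open U -> U x -> Ck_on 0 U M -> M x \in unitmx ->
  \forall y \near x, M y \in unitmx.
Proof.
move=> oU Ux CM uM; have d0 : 0 < `|\det (M x)| by rewrite normr_gt0 -unitfE -unitmxE.
have Cd : Ck_on 0 U (fun y => \det (M y) : R^o).
  by apply: Ck_det => // i j; exact: Ck_coord.
have /cvgrPdist_lt/(_ _ d0) := Cd x Ux.
apply: filterS => y; rewrite unitmxE unitfE => H; apply/eqP => E.
by move: H; rewrite E subr0 ltxx.
Qed.

(** The partial Jacobian matrix in the second variable, acting on rows. *)
Definition jacobian_snd k (Phi : R^o * 'rV[R]_k -> 'rV[R]_k) p : 'M[R]_k :=
  \matrix_(i, j) ('d Phi p (0, delta_mx 0 i)) 0 j.

Lemma jacobian_sndE k (Phi : R^o * 'rV[R]_k -> 'rV[R]_k) p h :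
  'd Phi p (0, h) = h *m jacobian_snd Phi p.
Proof.
have -> : ((0, h) : R^o * 'rV[R]_k) = \sum_i h 0 i *: (0, delta_mx 0 i).
  rewrite {1}[h]row_sum_delta.
  by elim/big_rec2: _ => // i y1 y2 _ <-; congr pair => /=; rewrite scaler0 addr0.
rewrite linear_sum; apply/rowP => j; rewrite summxE mxE; apply: eq_bigr => i _.
by rewrite linearZ /= !mxE.
Qed.

Section Curve.
Variables (k : nat) (Phi : R^o * 'rV[R]_k -> 'rV[R]_k) (U : set (R^o * 'rV[R]_k)).
Hypothesis oU : open U.
Hypothesis U0 : U (0, 0).
Hypothesis sPhi : smooth_on U Phi.
Hypothesis Phi0 : Phi (0, 0) = 0.
Variables (J : R^o * 'rV[R]_k -> 'M[R]_k) (A : 'M[R]_k).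
Hypothesis JE : forall p h, 'd Phi p (0, h) = h *m J p.
Hypothesis CJ : forall l, Ck_on l U J.
Hypothesis JA : J (0, 0) *m A = 1%:M.
Hypothesis AJ : A *m J (0, 0) = 1%:M.

Let J0_unit : J (0, 0) \in unitmx. Proof. by have [] := mulmx1_unit JA. Qed.

(** The zeros of Phi t are the fixed points of Psi t. *)
Let Psi (t : R^o) (s : 'rV[R]_k) : 'rV[R]_k := s - Phi (t, s) *m A.

(** On a small box the partial differential 1 - J A of Psi in s has norm at most
    1/2, since it vanishes at the origin. *)
Let box : exists2 r : R, 0 < r & forall (t : R) (s : 'rV[R]_k), `|t| <= r -> `|s| <= r ->
  [/\ U (t, s), J (t, s) \in unitmx &
      forall h : 'rV[R]_k, `|h *m (1%:M - J (t, s) *m A)| <= 2^-1 * `|h|].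
Proof.
pose N p : 'M[R]_k := 1%:M - J p *m A.
have CN : Ck_on 0 U N.
  apply: (@Ck_sub R 0 _ _ U (fun=> 1%:M) (fun p => J p *m A) oU).
    exact: Ck_cst.
  by apply: (@Ck_mulmx R 0 _ U _ _ _ J (fun=> A) oU (CJ 0)); exact: Ck_cst.
have N0 : N (0, 0) = 0 by rewrite /N JA subrr.
(* The norm of h *m M is at most k |M| |h|, so |N p| < 1 / (2 (k + 1)) gives the
   factor 1/2. *)
have e0 : 0 < (2 * (k%:R + 1))^-1 :> R by rewrite invr_gt0 mulr_gt0// ltr_wpDl.
have nearN : \forall p \near ((0, 0) : R^o * 'rV[R]_k), `|N p| < (2 * (k%:R + 1))^-1.
  have /cvgrPdist_lt/(_ _ e0) := CN (0, 0) U0.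
  by apply: filterS => p; rewrite N0 sub0r normrN.
have neardet : \forall p \near ((0, 0) : R^o * 'rV[R]_k), J p \in unitmx.
  exact: near_unitmx oU U0 (CJ 0) J0_unit.
have nearU : \forall p \near ((0, 0) : R^o * 'rV[R]_k), U p.
  exact: open_nbhs_nbhs.
have [d /= d0 H] := (nbhs_ballP _ _).1 (filterI nearU (filterI neardet nearN)).
exists (d / 2) => [|t s tr sr]; first by rewrite divr_gt0.
have dd : d / 2 < d by rewrite ltr_pdivrMr// ltr_pMr// ltr1n.
have [|Up [up Np]] := H (t, s).
  split; rewrite /= -ball_normE /= sub0r normrN.
    exact: le_lt_trans dd.
  exact: le_lt_trans dd.
split=> // h; apply: le_trans (mulmx_norm _ _) _.
rewrite ler_wpM2r//; apply: (@le_trans _ _ ((k%:R + 1) * (2 * (k%:R + 1))^-1)).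
  by rewrite ler_pM// ?lerDl// ltW.
by rewrite invfM mulrCA mulfV ?mulr1// gt_eqF// ltr_wpDl.
Qed.

Let dPsi p : U p ->
  has_diff (fun p => Psi p.1 p.2) p (fun h => h.2 - 'd Phi p h *m A).
Proof.
move=> Up; apply: has_diff_sub; first exact: has_diff_snd.
have -> : (fun p => Phi (p.1, p.2) *m A) = (fun p => mulmxr A (Phi p)).
  by apply/funext => -[].
have cA : continuous (mulmxr A : 'rV[R]_k -> 'rV[R]_k).
  exact: finite_dim_continuous (finite_dim_rV _).
exact: has_diff_comp (has_diff_diff (smooth_differentiable sPhi Up))
  (has_diff_linear _ cA).
Qed.

Let Psi00 : Psi 0 0 = 0. Proof. by rewrite /Psi Phi0 mul0mx subr0. Qed.

Let Psi_contraction (r : R) :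
  (forall (t : R) (s : 'rV[R]_k), `|t| <= r -> `|s| <= r ->
  [/\ U (t, s), J (t, s) \in unitmx &
      forall h : 'rV[R]_k, `|h *m (1%:M - J (t, s) *m A)| <= 2^-1 * `|h|]) ->
  forall (t : R) s s', `|t| <= r -> `|s| <= r -> `|s'| <= r ->
    `|Psi t s - Psi t s'| <= 2^-1 * `|s - s'|.
Proof.
move=> Hr t s s' tr sr s'r; apply: mx_norm_le => [|i j]; first by rewrite mulr_ge0// invr_ge0.
pose v := s - s'.
have Ep (c : R) : (t, s') + c *: ((0, v) : R^o * 'rV[R]_k) = (t, s' + c *: v).
  by congr pair => /=; rewrite scaler0 addr0.
have sc (c : R) : 0 <= c <= 1 -> `|s' + c *: v| <= r.
  move=> /andP[c0 c1]; have -> : s' + c *: v = (1 - c) *: s' + c *: s.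
    by rewrite scalerBr scalerBl scale1r addrCA addrA [c *: s + _]addrC addrAC.
  apply: le_trans (ler_normD _ _) _; rewrite !normrZ !ger0_norm ?subr_ge0//.
  apply: (@le_trans _ _ ((1 - c) * r + c * r)).
    by rewrite lerD// ler_wpM2l// subr_ge0.
  by rewrite -mulrDl subrK mul1r.
have Hd (c : R) : 0 <= c <= 1 ->
   has_diff (fun p : R^o * 'rV[R]_k => Psi p.1 p.2 i j : R^o)
     ((t, s') + c *: (0, v))
     (fun h => (h.2 - 'd Phi ((t, s') + c *: (0, v)) h *m A) i j).
  move=> c01; rewrite Ep; have [Uc _ _] := Hr _ _ tr (sc c c01).
  have cc : continuous (linear_map (@coord_linear R _ _ i j)) by exact: coord_continuous.
  exact: has_diff_comp (dPsi Uc) (has_diff_linear _ cc).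
have [c c01] := @mean_value_line R _ _ (t, s') (0, v) (fun c c01 => (Hd c c01).1).
rewrite (Hd c c01).2 /= Ep addr0 [s' + v]addrC subrK !mxE => ->.
have [_ _ Hc] := Hr _ _ tr (sc c c01).
apply: le_trans (Hc v); apply: le_trans (mx_entry_le _ i j).
by rewrite JE mulmxBr mulmx1 mulmxA !mxE.
Qed.

(** For each small t, Psi t is a contraction of a fixed ball, and s t is its fixed
    point.  Comparing two fixed points shows that s is Lipschitz at each t; then
    the first-order expansion of Phi at (t, s t) gives
    s' = - (d Phi / dt) J^-1, and this formula makes s of class C^(l+1) as soon
    as it is of class C^l. *)
Lemma implicit_curve_aux : exists (eps : R) (s : R^o -> 'rV[R]_k),
  [/\ 0 < eps, smooth_on [set t : R^o | `|t| < eps] s, s 0 = 0 &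
      forall t : R, `|t| < eps -> U (t, s t) /\ Phi (t, s t) = 0].
Proof.
have [r r0 Hr] := box; have contr := Psi_contraction Hr.
have [eps [eps0 epsr Heps]] : exists eps : R, [/\ 0 < eps, eps <= r &
    forall t : R, `|t| < eps -> `|Psi t 0| <= r / 2].
  have r2 : 0 < r / 2 by rewrite divr_gt0.
  have := differentiable_continuous (dPsi U0).1.
  move=> /cvgrPdist_le/(_ _ r2)/nbhs_ballP[d /= d0 Hd].
  exists (Num.min r d); split; rewrite ?lt_min ?r0 ?ge_min ?lexx// => t.
  rewrite lt_min => /andP[_ td]; have := Hd (t, 0).
  rewrite /= Psi00 sub0r normrN; apply; split; rewrite /= -ball_normE /= sub0r normrN//.
  by rewrite normr0.
have half_le (x y : R) : x <= 2^-1 * x + y -> x <= 2 * y.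
  by move=> H; lra.
have /choice[s sP] : forall t : R^o, exists s : 'rV[R]_k,
    `|t| < eps -> `|s| <= r /\ s = Psi t s.
  move=> t; have [te|] := boolP (`|t| < eps); last by exists 0.
  have tr : `|t| <= r by apply: le_trans epsr; exact: ltW.
  have [|x|x y|s sr E] := @half_contraction_fixpoint _ r (Psi t); last by exists s.
  - exact: ltW.
  - move=> xr; rewrite -[Psi t x](subrK (Psi t 0)) (le_trans (ler_normD _ _))//.
    rewrite (splitr r) lerD ?Heps//.
    apply: le_trans (contr _ _ _ tr xr _) _; first by rewrite normr0 ltW.
    by rewrite subr0 mulrC ler_wpM2r ?invr_ge0.
  - by move=> xr yr; exact: contr.
have sr t : `|t| < eps -> `|s t| <= r by move=> /sP[].
have sE t : `|t| < eps -> s t = Psi t (s t) by move=> /sP[].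
have tr (t : R) : `|t| < eps -> `|t| <= r by move=> /ltW/le_trans; exact.
have PhiE (t : R) : `|t| < eps -> Phi (t, s t) = 0.
  move=> te; have : Phi (t, s t) *m A = 0.
    by have := sE t te; rewrite /Psi => /eqP; rewrite -subr_eq0 opprB addrC subrK => /eqP.
  by move=> /(congr1 (fun x => x *m J (0, 0))); rewrite -mulmxA AJ mulmx1 mul0mx.
have s0 : s 0 = 0.
  have e0 : `|0 : R| < eps by rewrite normr0.
  have := contr 0 (s 0) 0 (tr _ e0) (sr _ e0).
  rewrite normr0 ltW// -sE// Psi00 !subr0 => /(_ isT) H.
  apply/eqP; rewrite -normr_le0; have := half_le `|s 0| 0; rewrite addr0 mulr0.
  exact.
have near_eps (t : R^o) : `|t| < eps -> \forall h \near (0 : R^o), `|t + h| < eps.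
  move=> te; have d0 : 0 < eps - `|t| by rewrite subr_gt0.
  apply/nbhs_ballP; exists (eps - `|t|) => //= h.
  rewrite -ball_normE /= sub0r normrN => hd; apply: le_lt_trans (ler_normD _ _) _.
  by rewrite addrC -ltrBrDr.
(* Split s (t + h) - s t into a difference in s, absorbed by the contraction
   factor, and a difference in t alone. *)
have lip (t : R^o) : `|t| < eps -> exists2 K : R, 0 <= K &
    \forall h \near (0 : R^o), `|s (t + h) - s t| <= K * `|h|.
  move=> te.
  have Hg : has_diff (fun t' : R^o => Psi t' (s t)) t
     (fun h => (0 - 'd Phi (t, s t) (h, 0) *m A)).
    have [Ut _ _] := Hr _ _ (tr t te) (sr t te).
    exact: has_diff_comp (has_diff_pair (has_diff_id t) (has_diff_cst (s t) t)) (dPsi Ut).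
  exists (2 * (`|'d (fun t' : R^o => Psi t' (s t)) t 1| + 1)).
    by rewrite mulr_ge0// addr_ge0.
  near=> h.
  have the : `|t + h| < eps by near: h; exact: near_eps.
  rewrite -mulrA; apply: half_le.
  have E : s (t + h) - s t = (Psi (t + h) (s (t + h)) - Psi (t + h) (s t)) +
      (Psi (t + h) (s t) - Psi t (s t)) by rewrite subrKA -(sE _ the) -(sE _ te).
  rewrite {1}E; apply: le_trans (ler_normD _ _) _; apply: lerD.
    exact: contr _ _ _ (tr _ the) (sr _ the) (sr _ te).
  have HD : `|Psi (t + h) (s t) - Psi t (s t) -
       'd (fun t' : R^o => Psi t' (s t)) t h| <= 1 * `|h|.
    by near: h; exact: (diff_eps Hg.1 ltr01).
  pose D := 'd (fun t' : R^o => Psi t' (s t)) t h.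
  have -> : Psi (t + h) (s t) - Psi t (s t) = D + (Psi (t + h) (s t) - Psi t (s t) - D).
    by rewrite [RHS]addrC subrK.
  rewrite mulrDl; apply: le_trans (ler_normD _ _) _; apply: lerD.
    by rewrite /D diff_scalar normrZ mulrC.
  exact: HD.
pose a t := 'd Phi (t, s t) (1, 0).
pose S (t : R^o) := - (a t *m invmx (J (t, s t))).
(* With sg the increment of s, the expansion reads h a + sg J = o(|h| + |sg|),
   where |sg| is at most K |h|; multiply by J^-1. *)
have ds (t : R^o) : `|t| < eps -> has_diff s t (fun h => h *: S t).
  move=> te; have [Uq Jq _] := Hr _ _ (tr t te) (sr t te).
  have Sl : linear (fun h : R^o => h *: S t).
    by move=> b x y; rewrite scalerDl scalerA.
  have [K K0 HK] := lip t te.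
  have [] := @differentiable_eps R _ _ s t (linear_map Sl); last first.
  - by move=> D E; split=> // v; rewrite E.
  - move=> e e0; pose c0 := k%:R * `|invmx (J (t, s t))|.
    have c00 : 0 <= c0 by rewrite mulr_ge0.
    have K1 : 0 < K + 1 by rewrite ltr_wpDl.
    have c1 : 0 < c0 + 1 by rewrite ltr_wpDl.
    pose e' := e / ((c0 + 1) * (K + 1)).
    have e'0 : 0 < e' by rewrite divr_gt0// mulr_gt0.
    have := diff_eps (smooth_differentiable sPhi Uq) e'0.
    move=> /nbhs_ballP[d /= d0 Hd].
    near=> h.
    have sgh : `|s (t + h) - s t| <= K * `|h| by near: h.
    have the : `|t + h| < eps by near: h; exact: near_eps.
    have hd : `|h| < d / (K + 1).
      near: h; apply/nbhs_ballP; exists (d / (K + 1)) => /=; first by rewrite divr_gt0.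
      by move=> h; rewrite -ball_normE /= sub0r normrN.
    pose sg := s (t + h) - s t.
    have hsg : `|((h, sg) : R^o * 'rV[R]_k)| <= (K + 1) * `|h|.
      rewrite prod_normE /= ge_max mulrDl mul1r lerDr mulr_ge0//=.
      by apply: le_trans sgh _; rewrite lerDl.
    have := Hd (h, sg); rewrite -ball_normE /= sub0r normrN.
    have -> : (t, s t) + ((h, sg) : R^o * 'rV[R]_k) = (t + h, s (t + h)).
      by congr pair; rewrite /sg addrC subrK.
    rewrite !PhiE// subr0 sub0r normrN => H.
    have -> : s (t + h) - s t - linear_map Sl h =
        'd Phi (t, s t) (h, sg) *m invmx (J (t, s t)).
      have -> : (h, sg) = h *: ((1, 0) : R^o * 'rV[R]_k) + (0, sg).
        by congr pair; rewrite /= ?scaler0 ?add0r ?addr0 // [RHS]mulr1.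
      have -> : 'd Phi (t, s t) (h *: ((1, 0) : R^o * 'rV[R]_k) + (0, sg)) =
          (h : R) *: a t + sg *m J (t, s t).
        rewrite linearD JE; congr (_ + _).
        exact: (linearZ_LR ('d Phi (t, s t)) (h : R)).
      rewrite mulmxDl (mulmxK Jq) -scalemxAl addrC.
      by rewrite -[linear_map Sl h]/((h : R) *: S t) /S scalerN opprK addrC.
    apply: le_trans (mulmx_norm _ _) _; rewrite -/c0.
    have {}H := H (le_lt_trans hsg _); apply: (@le_trans _ _ (c0 * (e' * ((K + 1) * `|h|)))).
      rewrite ler_wpM2l//; apply: le_trans (H _) _.
        by rewrite mulrC -ltr_pdivlMr.
      by rewrite ler_wpM2l// ltW.
    suff : forall x : R, 0 <= x -> c0 * (e' * ((K + 1) * x)) <= e * x by exact.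
    move=> x x0; have -> : c0 * (e' * ((K + 1) * x)) = e * (c0 / (c0 + 1)) * x.
      by rewrite /e'; field; rewrite !gt_eqF.
    by rewrite ler_wpM2r// ler_piMr ?(ltW e0)// ler_pdivrMr// mul1r lerDl.
  - exact: finite_dim_continuous finite_dim_R.
exists eps, s; split=> //; last first.
  by move=> t te; split; [have [] := Hr _ _ (tr t te) (sr t te)|exact: PhiE].
pose Ie := [set t : R^o | `|t| < eps].
have oI : open Ie by exact: open_norm_lt.
elim=> [|l IH].
  by move=> t te; exact: differentiable_continuous (ds t te).1.
split=> [t te|v]; first exact: (ds t te).1.
have Cts : Ck_on l Ie (fun t => (t, s t)).
  by apply: Ck_pair => //; exact: (@smooth_id R R^o Ie l).
have IU t : Ie t -> U (t, s t) by move=> te; have [] := Hr _ _ (tr t te) (sr t te).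
have fd := finite_dim_prod (@finite_dim_R R) (@finite_dim_rV R k).
suff H : Ck_on l Ie (fun t => v *: S t).
  by apply: (Ck_congr oI) H => t te; rewrite (ds t te).2.
apply: Ck_scale => //; first exact: Ck_cst.
apply: Ck_opp => //; apply: Ck_mulmx => //.
  exact: (@Ck_comp R l _ _ _ Ie U (fun t => (t, s t)) (fun p => 'd Phi p (1, 0))
    fd oI oU IU Cts (smooth_diff ((1, 0) : R^o * 'rV[R]_k) sPhi l)).
apply: Ck_invmx => //.
  by move=> t te; have [] := Hr _ _ (tr t te) (sr t te).
exact: (Ck_comp fd oI oU IU Cts (CJ l)).
Unshelve. all: by end_near.
Qed.
End Curve.

(** The implicit function theorem with one real parameter.  Injectivity of the
    partial differential suffices, both spaces having the same dimension. *)
Lemma implicit_curve k (Phi : R^o * 'rV[R]_k -> 'rV[R]_k)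
    (U : set (R^o * 'rV[R]_k)) :
  open U -> U (0, 0) -> smooth_on U Phi -> Phi (0, 0) = 0 ->
  (forall h, 'd Phi (0, 0) (0, h) = 0 -> h = 0) ->
  exists (eps : R) (s : R^o -> 'rV[R]_k),
  [/\ 0 < eps, smooth_on [set t : R^o | `|t| < eps] s, s 0 = 0 &
      forall t : R, `|t| < eps -> U (t, s t) /\ Phi (t, s t) = 0].
Proof.
move=> oU U0 sPhi Phi0 injPhi.
have uJ : jacobian_snd Phi (0, 0) \in unitmx.
  rewrite -row_free_unit; apply: inj_row_free => h.
  by rewrite -jacobian_sndE; exact: injPhi.
apply: (@implicit_curve_aux _ _ _ oU U0 sPhi Phi0 (jacobian_snd Phi)
  (invmx (jacobian_snd Phi (0, 0)))).
- exact: jacobian_sndE.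
- move=> l; apply: Ck_mx => // i j.
  have -> : (fun x => jacobian_snd Phi x i j : R^o) =
      (fun x => ('d Phi x (0, delta_mx 0 i)) 0 j).
    by apply/funext => x; rewrite mxE.
  by apply: Ck_coord => //; exact: smooth_diff sPhi l.
- exact: mulmxV.
- exact: mulVmx.
Qed.

End ImplicitCurve.

(** * Invariant Lagrangians in coordinates *)

Lemma pair_split (R : realType) (V W : lmodType R) (b : V * W) : b = (b.1, 0) + (0, b.2).
Proof. by case: b => b1 b2; congr pair; rewrite /= ?addr0 ?add0r. Qed.

Section Local.
Context {R : realType}.
Variables (F K : normedModType R) (fF : finite_dim F) (fK : finite_dim K).
Variables (O : set F) (L : F * F -> R^o) (D : set (K * F)) (B : K * F -> F) (g0 : K).
Let W : set (F * F) := [set z | O z.1].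
Hypothesis oO : open O.
Hypothesis sL : smooth_on W L.
Hypothesis oD : open D.
Hypothesis sB : smooth_on D B.
Hypothesis Dg0 : forall x, O x -> D (g0, x).
Hypothesis B1 : forall x, O x -> B (g0, x) = x.
Hypothesis BO : forall p, D p -> O p.2 -> O (B p).
Hypothesis Linv : forall p v, D p -> O p.2 -> L (B p, 'd B p (0, v)) = L (p.2, v).

(** D2L at z: the derivative along a of the derivative of L along b. *)
Definition hess z a b : R := 'd (fun y => 'd L y b) z a.
(** The fundamental vector field of eta in coordinates: B is the action and g0
    stands for the unit of the group. *)
Definition gen_field (eta : K) x : F := 'd B (g0, x) (eta, 0).
Definition dgen_field eta x w : F := 'd (fun y => gen_field eta y) x w.
(** The momentum <p, eta>, where (0, X) is the vertical lift of the fundamental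
    field X of eta. *)
Definition loc_mom eta (z : F * F) : R^o := 'd L z (0, gen_field eta z.1).
Definition loc_energy (z : F * F) : R^o := 'd L z (0, z.2) - L z.
(** Minus the exterior derivative of the Cartan 1-form of L. *)
Definition omega z a b : R := hess z b (0, a.1) - hess z a (0, b.1).
(** The complete lift (X, DX v) of the fundamental field X of eta. *)
Definition gen_lift eta (z : F * F) : F * F :=
  (gen_field eta z.1, dgen_field eta z.1 z.2).

Let oW : open W.
Proof. by apply: open_comp => // z _; exact: cvg_fst. Qed.

Let fFF : finite_dim (F * F)%type := finite_dim_prod fF fF.
Let fKF : finite_dim (K * F)%type := finite_dim_prod fK fF.

Lemma hess_sym z a b : W z -> hess z a b = hess z b a.
Proof. by move=> Wz; exact: diff_sym (@finite_dim_R R) oW Wz sL. Qed.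

Lemma hess_linear z a : W z -> linear (hess z a : _ -> R^o).
Proof. by move=> Wz r b c; rewrite !(hess_sym a _ Wz); exact: linearP. Qed.

Lemma smooth_gen_field eta : smooth_on O (gen_field eta).
Proof.
apply: (@smooth_comp R _ _ _ O D (fun x => (g0, x)) (fun p => 'd B p (eta, 0))) => //.
- by apply: smooth_pair => //; [exact: smooth_cst|exact: smooth_id].
- exact: smooth_diff.
Qed.

Lemma gen_fieldP x : linear (gen_field^~ x).
Proof.
move=> r a b; rewrite /gen_field -linearP; congr ('d B _ _).
by congr pair; rewrite /= scaler0 addr0.
Qed.

(** The symmetry of second derivatives of the action: differentiating the
    generator along M is generating the tangent action. *)
Lemma dgen_fieldE eta x w : O x ->
  dgen_field eta x w = 'd (fun p => 'd B p (0, w)) (g0, x) (eta, 0).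
Proof.
move=> Ox; rewrite (@diff_sym R _ _ D B (g0, x) (0, w) (eta, 0) fF oD (Dg0 Ox) sB).
have H : has_diff (fun p => 'd B p (eta, 0)) (g0, x) _ :=
  has_diff_diff (smooth_differentiable (smooth_diff (eta, 0) sB) (Dg0 Ox)).
rewrite /dgen_field /gen_field.
by have [_ ->] := has_diff_comp (has_diff_pair_r g0 x) H.
Qed.

Lemma dgen_fieldP x w : O x -> linear (fun eta => dgen_field eta x w).
Proof.
move=> Ox r a b; rewrite !dgen_fieldE// -linearP; congr ('d _ _ _).
by congr pair; rewrite /= scaler0 addr0.
Qed.

Lemma gen_liftP z : W z -> linear (gen_lift^~ z).
Proof.
move=> Wz r a b; rewrite /gen_lift (gen_fieldP z.1) (@dgen_fieldP z.1)//.
Qed.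

Lemma loc_momP z : linear (loc_mom^~ z).
Proof.
move=> r a b; rewrite /loc_mom (gen_fieldP z.1).
have -> : (0, r *: gen_field a z.1 + gen_field b z.1) =
    r *: (0, gen_field a z.1) + (0, gen_field b z.1) :> F * F.
  by congr pair; rewrite /= scaler0 addr0.
exact: linearP.
Qed.

Lemma smooth_loc_mom eta : smooth_on W (loc_mom eta).
Proof.
apply: smooth_diff_apply => //.
apply: smooth_pair => //; first exact: smooth_cst.
apply: (@smooth_comp R _ _ _ W O fst (gen_field eta)) => //.
- exact: smooth_fst.
- exact: smooth_gen_field.
Qed.

Lemma has_diff_energy z : W z -> has_diff loc_energy z
  (fun b => hess z b (0, z.2) - 'd L z (b.1, 0)).
Proof.
move=> Wz.
have H1 : has_diff (fun z : F * F => (0, z.2) : F * F) z (fun b => (0, b.2)).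
  exact: has_diff_pair (has_diff_cst _ _) (has_diff_snd _).
have H2 := has_diff_apply fFF (has_diff_id z) H1
  (fun v => smooth_differentiable (smooth_diff v sL) Wz).
apply: has_diff_eq (has_diff_sub H2 (has_diff_diff (smooth_differentiable sL Wz))) _.
move=> b; have E : 'd L z b = 'd L z (b.1, 0) + 'd L z (0, b.2).
  by rewrite {1}(pair_split b) linearD.
by rewrite [X in _ - X]E [X in _ - X]addrC opprD addrA addrK.
Qed.

Lemma has_diff_mom z eta : W z -> has_diff (loc_mom eta) z
  (fun b => hess z b (0, gen_field eta z.1) + 'd L z (0, dgen_field eta z.1 b.1)).
Proof.
move=> Wz.
have H0 : has_diff (fun z => gen_field eta z.1) z (fun b => dgen_field eta z.1 b.1).
  apply: has_diff_comp (has_diff_fst z) _; apply: has_diff_diff.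
  exact: smooth_differentiable (smooth_gen_field eta) Wz.
exact: has_diff_apply fFF (has_diff_id z) (has_diff_pair (has_diff_cst _ _) H0)
  (fun v => smooth_differentiable (smooth_diff v sL) Wz).
Qed.

Lemma diff_fibre z v : W z -> has_diff (fun u => L (z.1, u)) v (fun w => 'd L (z.1, v) (0, w)).
Proof.
move=> Wz; have Wv : W (z.1, v) by [].
exact: has_diff_comp (has_diff_pair_r z.1 v)
  (has_diff_diff (smooth_differentiable sL Wv)).
Qed.

(** Invariance of L differentiated along the fibre: the fibre derivative of L is
    preserved by the tangent action. *)
Lemma inv_fibre p v b : D p -> O p.2 ->
  'd L (B p, 'd B p (0, v)) (0, 'd B p (0, b)) = 'd L (p.2, v) (0, b).
Proof.
move=> Dp Op; have BOp := BO Dp Op.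
have HB : has_diff (fun v => 'd B p (0, v)) v (fun w => 'd B p (0, w)).
  have dBc : continuous ('d B p) := diff_continuous (smooth_differentiable sB Dp).
  exact: has_diff_comp (has_diff_pair_r 0 v) (has_diff_linear _ dBc).
have H1 := has_diff_comp HB (diff_fibre ('d B p (0, v)) (BOp : W (B p, 0))).
have H2 := diff_fibre v (Op : W (p.2, 0)).
have E : (fun v => L (B p, 'd B p (0, v))) = (fun v => L (p.2, v)).
  by apply/funext => u; exact: Linv.
by move: H1; rewrite E => H1; exact: (has_diff_unique H1 H2 b).
Qed.

(** The previous identity differentiated along the group at the unit.  The second
    term appears because the tangent action also moves the vector b along which L
    is differentiated. *)
Lemma inv_mixed z eta b : W z ->
  hess z (gen_lift eta z) (0, b) + 'd L z (0, dgen_field eta z.1 b) = 0.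
Proof.
move=> Wz; set p0 := (g0, z.1) : K * F.
have Dp0 : D p0 by exact: Dg0.
have dB v : has_diff (fun p => 'd B p (0, v)) p0 ('d (fun p => 'd B p (0, v)) p0).
  apply: has_diff_diff; exact: smooth_differentiable (smooth_diff _ sB) Dp0.
have dB1 v : 'd B p0 (0, v) = v.
  have H := has_diff_comp (has_diff_pair_r g0 z.1)
    (has_diff_diff (smooth_differentiable sB Dp0)).
  apply: (has_diff_unique H); apply: has_diff_near (has_diff_id z.1).
  by apply: filterS (open_nbhs_nbhs (conj oO Wz)) => y Oy; rewrite B1.
have cE : (B p0, 'd B p0 (0, z.2)) = z.
  by rewrite dB1 (B1 (Wz : O z.1)) -surjective_pairing.
have Hc := has_diff_pair (has_diff_diff (smooth_differentiable sB Dp0)) (dB z.2).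
have Hw := has_diff_pair (has_diff_cst (0 : F) p0) (dB b).
have wE : (0 : F, 'd B p0 (0, b)) = (0, b) by rewrite dB1.
have H1 := has_diff_apply_at fFF cE wE Hc Hw
  (fun v => smooth_differentiable (smooth_diff v sL) Wz).
have H2 : has_diff (fun p : K * F => 'd L (p.2, z.2) (0, b)) p0
   (fun h => 'd (fun y => 'd L y (0, b)) (z.1, z.2) (h.2, 0)).
  have Hz : has_diff (fun y => 'd L y (0, b)) (p0.2, z.2)
      ('d (fun y => 'd L y (0, b)) (z.1, z.2)).
    apply: has_diff_diff; apply: (smooth_differentiable (smooth_diff _ sL)).
    exact: Wz.
  exact: has_diff_comp (has_diff_pair (has_diff_snd p0) (has_diff_cst z.2 p0)) Hz.
have {}H2 : has_diff (fun p => 'd L (B p, 'd B p (0, z.2)) (0, 'd B p (0, b))) p0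
   (fun h => 'd (fun y => 'd L y (0, b)) (z.1, z.2) (h.2, 0)).
  apply: has_diff_near H2; near=> p; apply/esym/inv_fibre.
    by near: p; exact: open_nbhs_nbhs.
  near: p; have H : open [set p : K * F | O p.2].
    by apply: open_comp => // y _; exact: cvg_snd.
  by apply: open_nbhs_nbhs; split.
have E1 := dgen_fieldE eta z.2 (Wz : O z.1).
have E2 := dgen_fieldE eta b (Wz : O z.1).
rewrite /gen_lift E1 E2.
exact: etrans (has_diff_unique H1 H2 (eta, 0)) (linear0 _).
Unshelve. all: by end_near. Qed.

(** The two assumptions on G say that it is the value at z of the Euler-Lagrange
    field; the second one turns the only first-order term of dE into a
    second-order one. *)
Lemma energy_omega z G b : W z -> G.1 = z.2 ->
  (forall c, hess z G (0, c) = 'd L z (c, 0)) ->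
  'd loc_energy z b = omega z G b.
Proof.
by move=> Wz G1 GE; have [_ ->] := has_diff_energy Wz; rewrite /omega G1 GE.
Qed.

(** [inv_mixed] turns the first-order term of the differential of the momentum
    into a second-order one. *)
Lemma mom_omega z eta b : W z ->
  'd (loc_mom eta) z b = omega z (gen_lift eta z) b.
Proof.
move=> Wz; have [_ ->] := has_diff_mom eta Wz; rewrite /omega; congr (_ + _).
by apply/eqP; rewrite -addr_eq0 addrC inv_mixed.
Qed.

Lemma omega_linear z b : W z -> linear (fun a => omega z a b : R^o).
Proof.
move=> Wz r a c.
have E1 : hess z b (0, (r *: a + c).1) = r * hess z b (0, a.1) + hess z b (0, c.1).
  rewrite -(hess_linear b Wz r); congr (hess z b).
  by congr pair; rewrite /= scaler0 addr0.
have E2 : hess z (r *: a + c) (0, b.1) = r * hess z a (0, b.1) + hess z c (0, b.1).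
  exact: linearP.
rewrite /omega E1 E2.
have ringE (x y x' y' : R) : r * x + y - (r * x' + y') = r * (x - x') + (y - y').
  by ring.
exact: ringE.
Qed.

(** Vertical b first force the horizontal part of a to vanish; then horizontal b
    force the vertical part to vanish. *)
Lemma omega_nondegenerate z a : W z ->
  (forall v, (forall w, hess z (0, v) (0, w) = 0) -> v = 0) ->
  (forall b, omega z a b = 0) -> a = 0.
Proof.
move=> Wz reg om.
have a1 : a.1 = 0.
  apply: reg => w; rewrite hess_sym//; have := om (0, w).
  by rewrite /omega /= (_ : hess z a (0, 0) = 0) ?subr0//; rewrite hess_sym// /hess linear0.
have a2 : a.2 = 0.
  apply: reg => w; have := om (w, 0); rewrite /omega a1 /=.
  rewrite (_ : hess z _ (0, 0) = 0); last by rewrite hess_sym// /hess linear0.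
  by rewrite sub0r => /eqP; rewrite oppr_eq0 {1}(pair_split a) a1 add0r => /eqP.
by rewrite [a]surjective_pairing a1 a2.
Qed.

Variables (k : nat) (E : 'I_k -> K).
Hypothesis spanE : forall eta, exists c : 'I_k -> R, eta = \sum_a c a *: E a.

(** The matrix (g_ab): the Hessian of L on the fundamental fields of the E a. *)
Definition gram (z : F * F) : 'M[R]_k :=
  \matrix_(a, b) hess z (0, gen_field (E a) z.1) (0, gen_field (E b) z.1).

(** The combination of the vertical lifts of the fundamental fields of the E a
    with coefficients h. *)
Definition vert (z : F * F) (h : 'rV[R]_k) : F * F :=
  \sum_a h 0 a *: (0, gen_field (E a) z.1).

Definition dmom (z b : F * F) : 'rV[R]_k := \row_a 'd (loc_mom (E a)) z b.

Lemma vert_linear z : linear (vert z).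
Proof.
move=> r g h; rewrite /vert scaler_sumr -big_split; apply: eq_bigr => a _.
by rewrite !mxE scalerDl scalerA.
Qed.

Lemma dmom_linear z : linear (dmom z).
Proof. by move=> r b c; apply/rowP => a; rewrite !mxE linearP. Qed.

Lemma dmom_vert z h : W z -> dmom z (vert z h) = h *m gram z.
Proof.
move=> Wz; apply/rowP => a; rewrite !mxE /vert linear_sum; apply: eq_bigr => b _.
have Ed : 'd (loc_mom (E a)) z (0, gen_field (E b) z.1) =
    hess z (0, gen_field (E b) z.1) (0, gen_field (E a) z.1).
  have [_ ->] := has_diff_mom (E a) Wz.
  by rewrite /dgen_field linear0 [X in _ + X](linear0 ('d L z)) addr0.
by rewrite mxE -Ed; exact: (linearZ_LR ('d (loc_mom (E a)) z)).
Qed.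

Lemma mom_zero_span z b : W z -> dmom z b = 0 ->
  forall eta, 'd (loc_mom eta) z b = 0.
Proof.
move=> Wz b0 eta; have [c ->] := spanE eta.
have -> : loc_mom (\sum_a c a *: E a) = fun y => \sum_a c a *: loc_mom (E a) y.
  apply/funext => y; rewrite -[loc_mom _ y]/(linear_map (loc_momP y) _) linear_sum.
  by apply: eq_bigr => a _; rewrite linearZ.
have H a := has_diff_scale (has_diff_cst (c a : R^o) z)
  (has_diff_diff (smooth_differentiable (smooth_loc_mom (E a)) Wz)).
have [_ ->] := has_diff_sum (index_enum _) H.
apply: big1 => a _; rewrite scale0r addr0.
by have /rowP/(_ a) := b0; rewrite !mxE => ->; rewrite scaler0.
Qed.

(** Subtracting from b the vertical vector with coefficients dmom b gram^-1 gives a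
    vector killed by all momenta, hence by dE.  So dE is the combination of the
    d p_a with coefficients x, the column gram^-1 (dE on the vertical lifts),
    hence equal to d p_xi for xi = sum_a x_a E_a. *)
Lemma equilibrium_of_kernel z G : W z -> gram z \in unitmx ->
  (forall v, (forall w, hess z (0, v) (0, w) = 0) -> v = 0) ->
  G.1 = z.2 -> (forall c, hess z G (0, c) = 'd L z (c, 0)) ->
  (forall b, (forall eta, 'd (loc_mom eta) z b = 0) -> 'd loc_energy z b = 0) ->
  exists xi, G = gen_lift xi z.
Proof.
move=> Wz ug reg G1 GE ker.
pose phi (c : 'I_k) := 'd loc_energy z (0, gen_field (E c) z.1).
pose x : 'cV[R]_k := invmx (gram z) *m \col_c phi c.
pose xi := \sum_a x a 0 *: E a; exists xi.
have en b : 'd loc_energy z b = (dmom z b *m x) 0 0.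
  pose h := dmom z b *m invmx (gram z).
  have : 'd loc_energy z (b - vert z h) = 0.
    apply: ker; apply: mom_zero_span => //.
    rewrite -[dmom z _]/(linear_map (dmom_linear z) _) linearB /= dmom_vert//.
    by rewrite mulmxKV// subrr.
  rewrite linearB => /eqP; rewrite subr_eq0 => /eqP ->.
  rewrite /x mulmxA -/h mxE /vert linear_sum; apply: eq_bigr => c _.
  by rewrite [X in _ * X]mxE; exact: (linearZ_LR ('d loc_energy z)).
have momxi b : 'd (loc_mom xi) z b = (dmom z b *m x) 0 0.
  rewrite mom_omega// /xi.
  transitivity (linear_map (omega_linear b Wz) (linear_map (gen_liftP Wz)
    (\sum_a x a 0 *: E a))) => //.
  rewrite !linear_sum mxE; apply: eq_bigr => a _.
  have -> : dmom z b 0 a = omega z (gen_lift (E a) z) b by rewrite mxE mom_omega.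
  by rewrite mulrC !linearZ.
apply/subr0_eq/(omega_nondegenerate Wz reg) => b.
have -> : omega z (G - gen_lift xi z) b = omega z G b - omega z (gen_lift xi z) b.
  exact: (linearB (linear_map (omega_linear b Wz))).
by rewrite -energy_omega// -mom_omega// en momxi subrr.
Qed.

Lemma kernel_of_equilibrium z G xi b : W z ->
  G.1 = z.2 -> (forall c, hess z G (0, c) = 'd L z (c, 0)) ->
  G = gen_lift xi z -> (forall eta, 'd (loc_mom eta) z b = 0) ->
  'd loc_energy z b = 0.
Proof.
by move=> Wz G1 GE Gxi ker; rewrite (energy_omega _ Wz G1 GE) Gxi -mom_omega.
Qed.

(** Correct the line z0 + t b by vertical vectors so that the momentum stays
    constant; the equation for the coefficients s t of the correction has partial
    Jacobian gram z0 at the origin.  As b is killed by all momenta, s' 0 = 0, so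
    that the corrected curve still has velocity b. *)
Lemma level_curve z0 b : W z0 -> gram z0 \in unitmx ->
  (forall eta, 'd (loc_mom eta) z0 b = 0) ->
  exists (eps : R) (z : R^o -> F * F),
    [/\ 0 < eps, smooth_on [set t : R^o | `|t| < eps] z, z 0 = z0,
        has_diff z 0 (fun h => (h : R) *: b) &
        forall t : R, `|t| < eps ->
          W (z t) /\ forall eta, loc_mom eta (z t) = loc_mom eta z0].
Proof.
move=> Wz ug ker.
pose al (p : R^o * 'rV[R]_k) : F * F := z0 + ((p.1 : R) *: b + vert z0 p.2).
have al_lin : linear (fun p : R^o * 'rV[R]_k => (p.1 : R) *: b + vert z0 p.2).
  move=> r p q; rewrite /= vert_linear scalerDr scalerDl -scalerA.
  by rewrite -!addrA; congr (_ + _); rewrite addrCA.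
have fRk := finite_dim_prod (@finite_dim_R R) (@finite_dim_rV R k).
pose l := linear_map al_lin; have lc : continuous l by exact: finite_dim_continuous.
have dal p : has_diff al p l.
  apply: has_diff_eq (has_diff_add (has_diff_cst z0 p) (has_diff_linear p lc)) _.
  by move=> h; rewrite add0r.
have sal k' : Ck_on k' setT al.
  exact: (Ck_add openT (Ck_cst k' setT z0) (Ck_linear k' setT lc)).
pose U := al @^-1` W.
have oU : open U by apply: open_comp => // p _; exact: (sal 0%N).
have al0 : al (0, 0) = z0.
  by rewrite /al scale0r add0r /vert big1 ?addr0// => a _; rewrite mxE scale0r.
have U0 : U (0, 0) by rewrite /U /= al0.
pose Phi p : 'rV[R]_k := \row_a (loc_mom (E a) (al p) - loc_mom (E a) z0).
have sPhi : smooth_on U Phi.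
  apply: smooth_mx => // i a.
  have -> : (fun p => Phi p i a : R^o) =
      (fun p => loc_mom (E a) (al p) - loc_mom (E a) z0).
    by apply/funext => p; rewrite mxE.
  apply: smooth_sub => //; last exact: smooth_cst.
  apply: (@smooth_comp R _ _ _ U W al (loc_mom (E a)) fFF oU oW) => //.
    by move=> k'; apply: Ck_subset (sal k').
  exact: smooth_loc_mom.
have dPhi : has_diff Phi (0, 0) (fun q => dmom z0 (l q)).
  apply: has_diff_mx => i a.
  have -> : (fun p => Phi p i a : R^o) =
      (fun p => loc_mom (E a) (al p) - loc_mom (E a) z0).
    by apply/funext => p; rewrite mxE.
  have Wal : W (al (0, 0)) by rewrite al0.
  have H := has_diff_sub (has_diff_comp (dal (0, 0))
    (has_diff_diff (smooth_differentiable (smooth_loc_mom (E a)) Wal)))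
    (has_diff_cst (loc_mom (E a) z0 : R^o) _).
  by apply: has_diff_eq H _ => q; rewrite subr0 mxE al0.
have Phi0 : Phi (0, 0) = 0 by apply/rowP => a; rewrite !mxE al0 subrr.
have lE t h : dmom z0 (l (t, h)) = h *m gram z0.
  have -> : l (t, h) = (t : R) *: b + vert z0 h by [].
  rewrite -dmom_vert// -[LHS]/(linear_map (dmom_linear z0) _) linearD linearZ /=.
  rewrite [X in _ *: X + _](_ : _ = 0) ?scaler0 ?add0r//.
  by apply/rowP => a; rewrite !mxE ker.
have inj h : 'd Phi (0, 0) (0, h) = 0 -> h = 0.
  rewrite dPhi.2 lE => H.
  by rewrite -[h](mulmxK ug) H mul0mx.
have [eps [s [eps0 ss s0 HPhi]]] := implicit_curve oU U0 sPhi Phi0 inj.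
exists eps, (fun t => al (t, s t)).
pose I := [set t : R^o | `|t| < eps].
have I0 : I 0 by rewrite /I /= normr0.
have oI : open I by exact: open_norm_lt.
have sts : smooth_on I (fun t => (t, s t)).
  by apply: smooth_pair => //; exact: smooth_id.
have dts : has_diff (fun t : R^o => (t, s t)) 0 (fun h => (h, 'd s 0 h)).
  exact: has_diff_pair (has_diff_id _) (has_diff_diff (smooth_differentiable ss I0)).
have ds0 h : 'd s 0 h = 0.
  have dPhi' : has_diff Phi ((0 : R^o), s 0) (fun q => dmom z0 (l q)) by rewrite s0.
  have H := has_diff_comp dts dPhi'.
  have H0 : has_diff (fun t : R^o => Phi (t, s t)) 0 (fun=> 0).
    apply: has_diff_near (has_diff_cst (0 : 'rV[R]_k) _).
    apply: filterS (open_nbhs_nbhs (conj oI I0)) => t It.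
    by have [_ ->] := HPhi t It.
  have := has_diff_unique H H0 h; rewrite lE => E0.
  by rewrite -['d s 0 h](mulmxK ug) E0 mul0mx.
split; first exact: eps0.
- apply: (@smooth_comp R _ _ _ I setT (fun t => (t, s t)) al fRk oI openT) => //.
- by rewrite s0 al0.
- apply: has_diff_eq (has_diff_comp dts (dal _)) _ => h; rewrite ds0.
  have -> : l (h, 0) = (h : R) *: b + vert z0 0 by [].
  by rewrite -[vert z0 0]/(linear_map (vert_linear z0) 0) linear0 addr0.
- move=> t It; have [Ut Pt] := HPhi t It; split; first exact: Ut.
  move=> eta; have [c ->] := spanE eta.
  rewrite -[LHS]/(linear_map (loc_momP _) _) -[RHS]/(linear_map (loc_momP _) _).
  rewrite !linear_sum; apply: eq_bigr => a _; rewrite !linearZ; congr (_ *: _).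
  by apply/eqP; rewrite -subr_eq0; have /rowP/(_ a) := Pt; rewrite !mxE => ->.
Qed.

End Local.

(** * Charts of a manifold and of its tangent bundle *)

Local Notation dom := Defs.dom.

Section ChartChanges.
Context {R : realType} {F : normedModType R} {M : topologicalType}.
Variable (MA : manifold_data F M).
Hypothesis mM : smooth_manifold MA.
Implicit Types c d e : chart F M.

(** The change of components of tangent vectors at m from the chart c to the
    chart d. *)
Definition coord_change c d m : F -> F := 'd (fwd d \o bwd c) (fwd c m).

Lemma chart_atP m : atlas MA (chart_at MA m) /\ dom (chart_at MA m) m.
Proof. by have [_ H _ _] := mM; exact: H. Qed.

Lemma chart_bwdK c m : atlas MA c -> dom c m -> bwd c (fwd c m) = m.
Proof. by have [_ _ H _] := mM; move=> /H[_ _ + _ _]; exact. Qed.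

Lemma open_chart_image c (A : set M) : atlas MA c -> open A ->
  open (fwd c @` (dom c `&` A)).
Proof.
move=> Ac oA; have [_ _ H _] := mM; have [_ oim bK _ cb] := H c Ac.
rewrite openE => _ [m [cm Am] <-]; rewrite /interior.
have im : (fwd c @` dom c) (fwd c m) by exists m.
have A1 : \forall y \near fwd c m, (fwd c @` dom c) y by exact: open_nbhs_nbhs.
have A2 : \forall y \near fwd c m, A (bwd c y).
  by apply: (cb _ im); rewrite bK//; exact: open_nbhs_nbhs.
apply: filterS2 A1 A2 => y [m' cm' <-]; rewrite bK// => Am'.
by exists m'.
Qed.

Lemma open_chart_codom c : atlas MA c -> open (fwd c @` dom c).
Proof. by move=> Ac; rewrite -[dom c]setIT; apply: open_chart_image => //; exact: openT. Qed.

Lemma near_bwd c (A : set M) m : atlas MA c -> open A -> dom c m -> A m ->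
  \forall y \near fwd c m, [/\ fwd c (bwd c y) = y, dom c (bwd c y) & A (bwd c y)].
Proof.
move=> Ac oA cm Am.
have : (fwd c @` (dom c `&` A)) (fwd c m) by exists m.
move=> /(conj (open_chart_image Ac oA))/open_nbhs_nbhs; apply: filterS.
by move=> y [m' [cm' Am'] <-]; rewrite chart_bwdK.
Qed.

Lemma open_dom c : atlas MA c -> open (dom c).
Proof. by have [_ _ H _] := mM; move=> /H[]. Qed.

Lemma smooth_transition c d : atlas MA c -> atlas MA d ->
  smooth_on (fwd c @` (dom c `&` dom d)) (fwd d \o bwd c).
Proof. by have [_ _ _] := mM; exact. Qed.

Lemma transition_diff c d m : atlas MA c -> atlas MA d -> dom c m -> dom d m ->
  has_diff (fwd d \o bwd c) (fwd c m) (coord_change c d m).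
Proof.
move=> Ac Ad cm dm; apply: has_diff_diff.
by apply: smooth_differentiable (smooth_transition Ac Ad) _; exists m.
Qed.

Lemma source_change (W : normedModType R) (k : M -> W) c d m :
  atlas MA c -> atlas MA d -> dom c m -> dom d m ->
  differentiable (k \o bwd c) (fwd c m) ->
  has_diff (k \o bwd d) (fwd d m)
    (fun v => 'd (k \o bwd c) (fwd c m) (coord_change d c m v)).
Proof.
move=> Ac Ad cm dm dk.
have H : has_diff (k \o bwd c) ((fwd c \o bwd d) (fwd d m)) ('d (k \o bwd c) (fwd c m)).
  by rewrite /= chart_bwdK//; exact: has_diff_diff.
apply: has_diff_near (has_diff_comp (transition_diff Ad Ac dm cm) H).
apply: filterS (near_bwd Ad (open_dom Ac) dm cm) => y [_ _ cy] /=.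
by rewrite (chart_bwdK Ac cy).
Qed.

Lemma target_change (V : normedModType R) (h : V -> M) (y : V) c d :
  atlas MA c -> atlas MA d -> dom d (h y) ->
  (\forall y' \near y, dom c (h y')) ->
  differentiable (fwd c \o h) y ->
  has_diff (fwd d \o h) y
    (fun v => coord_change c d (h y) ('d (fwd c \o h) y v)).
Proof.
move=> Ac Ad dh ch df; have chy := nbhs_singleton ch.
have := has_diff_comp (has_diff_diff df) (transition_diff Ac Ad chy dh).
by apply: has_diff_near; apply: filterS ch => y' cy' /=; rewrite chart_bwdK.
Qed.

Lemma coord_change_trans c d e m v :
  atlas MA c -> atlas MA d -> atlas MA e -> dom c m -> dom d m -> dom e m ->
  coord_change d e m (coord_change c d m v) = coord_change c e m v.
Proof.
move=> Ac Ad Ae cm dm em.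
have H := source_change Ad Ac dm cm (transition_diff Ad Ae dm em).1.
by rewrite /coord_change -(H.2 v).
Qed.

Lemma coord_change_id c m v : atlas MA c -> dom c m -> coord_change c c m v = v.
Proof.
move=> Ac cm.
have H : has_diff (fwd c \o bwd c) (fwd c m) id.
  apply: has_diff_near (has_diff_id _).
  by apply: filterS (near_bwd Ac (open_dom Ac) cm cm) => y [E _ _]; exact: esym E.
exact: H.2.
Qed.

Let TA := tangent_data MA.
Local Notation TC := (@tangent_chart R F M MA).

Lemma tangent_fwdE c (u : tangent MA) :
  fwd (TC c) u = (fwd c u.1, coord_change (chart_at MA u.1) c u.1 u.2).
Proof. by []. Qed.

Lemma tangent_bwdE c m v : atlas MA c -> dom c m ->
  bwd (TC c) (fwd c m, v) = (m, coord_change c (chart_at MA m) m v).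
Proof.
move=> Ac cm; rewrite /= /mdiff /= chart_bwdK//.
Qed.

Lemma tangent_bwdK c (u : tangent MA) : atlas MA c -> dom c u.1 ->
  bwd (TC c) (fwd (TC c) u) = u.
Proof.
move=> Ac cu; have [Am dm] := chart_atP u.1.
rewrite tangent_fwdE tangent_bwdE// coord_change_trans// coord_change_id//.
by case: u {cu Am dm}.
Qed.

Lemma tangent_fwdK c z : atlas MA c -> (fwd c @` dom c) z.1 ->
  dom c (bwd (TC c) z).1 /\ fwd (TC c) (bwd (TC c) z) = z.
Proof.
case: z => x v Ac [m cm xE]; have {}xE : fwd c m = x := xE.
have [Am dm] := chart_atP m; rewrite -xE.
rewrite tangent_bwdE//; split=> //.
by rewrite tangent_fwdE/= coord_change_trans// coord_change_id.
Qed.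

Lemma tangent_codom c : atlas MA c ->
  fwd (TC c) @` [set u : tangent MA | dom c u.1] = [set z | (fwd c @` dom c) z.1].
Proof.
move=> Ac; apply/seteqP; split=> [_ [u cu <-]|z zc]; first by exists u.1.
by have [? ?] := tangent_fwdK Ac zc; exists (bwd (TC c) z).
Qed.

(** The image in the natural chart of c of the part of TM over the domain of d. *)
Definition dom2 c d : set (F * F) := [set z | (fwd c @` (dom c `&` dom d)) z.1].

Lemma open_dom2 c d : atlas MA c -> atlas MA d -> open (dom2 c d).
Proof.
move=> Ac Ad; apply: open_comp; first by move=> z _; exact: cvg_fst.
by apply: open_chart_image => //; exact: open_dom.
Qed.

(** The transition map of the natural charts is (x, v) |-> (h x, 'd h x v) for the
    transition map h of M. *)
Lemma smooth_tangent_transition c d : finite_dim F -> atlas MA c -> atlas MA d ->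
  smooth_on (dom2 c d) (fwd (TC d) \o bwd (TC c)).
Proof.
move=> fF Ac Ad; have oD := open_dom2 Ac Ad.
have oO := open_chart_image Ac (open_dom Ad).
pose h (z : F * F) := (fwd d \o bwd c) z.1.
have sh : smooth_on (dom2 c d) h.
  apply: (@smooth_comp R _ _ _ (dom2 c d) _ fst (fwd d \o bwd c) fF oD oO) => //.
    exact: smooth_fst.
  exact: smooth_transition.
have sdh : smooth_on (dom2 c d) (fun z => 'd h z (z.2, 0)).
  apply: smooth_diff_apply => //; first exact: finite_dim_prod.
  by apply: smooth_pair => //; [exact: smooth_snd|exact: smooth_cst].
apply: (smooth_congr oD) (smooth_pair oD sh sdh) => -[x v] [m [cm dm] xE].
have {}xE : fwd c m = x := xE.
have [Am dmm] := chart_atP m.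
have -> : 'd h (x, v) (v, 0) = coord_change c d m v.
  have H := transition_diff Ac Ad cm dm; rewrite xE in H.
  have [_ ->] := has_diff_comp (has_diff_fst (x, v)) H.
  by [].
have -> : (fwd (TC d) \o bwd (TC c)) (x, v) = fwd (TC d) (bwd (TC c) (fwd c m, v)).
  by rewrite xE.
rewrite tangent_bwdE// tangent_fwdE coord_change_trans//.
by congr pair; rewrite /h /= -xE chart_bwdK.
Qed.

End ChartChanges.

(** * The Lagrangian, its energy and its Hessian in a chart *)

Section LagrangianInCharts.
Context {R : realType} {F : normedModType R} {M : topologicalType}.
Variables (MA : manifold_data F M) (L : tangent MA -> R^o).
Hypothesis mM : smooth_manifold MA.
Hypothesis sL : msmooth (tangent_data MA) (model_data R^o) L.
Let TA := tangent_data MA.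
Local Notation TC := (@tangent_chart R F M MA).

Definition chart_lagrangian c : F * F -> R^o := L \o bwd (TC c).

Definition chart_fibres (c : chart F M) : set (F * F) :=
  [set z | (fwd c @` dom c) z.1].

Lemma smooth_chart_lagrangian c : atlas MA c ->
  smooth_on (chart_fibres c) (chart_lagrangian c).
Proof.
move=> Ac; have [|_] := sL (c := TC c) (c' := id_chart R^o) _ erefl.
  by exists c.
by rewrite preimage_setT !setIT tangent_codom.
Qed.

Lemma lagrangian_fibre c m v : atlas MA c -> dom c m ->
  L (m, v) = chart_lagrangian c (fwd c m, coord_change (chart_at MA m) c m v).
Proof.
by move=> Ac cm; rewrite /chart_lagrangian -[in LHS](@tangent_bwdK _ _ _ _ mM c (m, v)).
Qed.

(** On a fibre, the fixed chart c and the preferred chart differ by a linear map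
    only. *)
Lemma has_diff_fibre c m v : atlas MA c -> dom c m ->
  has_diff (fun w => L (m, v + w)) 0
    (fun w => 'd (chart_lagrangian c) (fwd (TC c) (m, v))
       (0, coord_change (chart_at MA m) c m w)).
Proof.
move=> Ac cm; have [Am dm] := chart_atP mM m.
have E : (fun w => L (m, v + w)) = (fun w => chart_lagrangian c
   (fwd c m, coord_change (chart_at MA m) c m (v + w))).
  by apply/funext => w; exact: lagrangian_fibre.
have cc : continuous (coord_change (chart_at MA m) c m).
  exact: diff_continuous (transition_diff mM Am Ac dm cm).1.
have H1 : has_diff (fun w => v + w) 0 id.
  apply: has_diff_eq (has_diff_add (has_diff_cst v _) (has_diff_id _)) _.
  by move=> w; rewrite add0r.
have H2 : has_diff (fun w => (fwd c m, coord_change (chart_at MA m) c m (v + w))) 0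
    (fun w => (0, coord_change (chart_at MA m) c m w)).
  apply: has_diff_pair; first exact: has_diff_cst.
  exact: has_diff_comp H1 (has_diff_linear _ cc).
have Wz : chart_fibres c (fwd (TC c) (m, v)) by exists m.
have Hz : has_diff (chart_lagrangian c)
    (fwd c m, coord_change (chart_at MA m) c m (v + 0))
    ('d (chart_lagrangian c) (fwd (TC c) (m, v))).
  rewrite addr0; apply: has_diff_diff.
  exact: smooth_differentiable (smooth_chart_lagrangian Ac) Wz.
by rewrite E; exact: has_diff_comp H2 Hz.
Qed.

(** The differential is taken in the preferred chart at u; on vertical vectors it is
    a derivative along the fibre, which does not depend on the chart. *)
Lemma vdiff_vertical_lift c (u : tangent MA) w : atlas MA c -> dom c u.1 ->
  vdiff TA L u (vertical_lift w u) =
  'd (chart_lagrangian c) (fwd (TC c) u) (0, coord_change (chart_at MA u.1) c u.1 w).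
Proof.
case: u => m v Ac cm; have [Am dm] := chart_atP mM m.
set cm' := chart_at MA m.
have -> : @vertical_lift R F M MA w (m, v) = (0, w).
  rewrite /vertical_lift /velocity /mdiff /=.
  have H : has_diff (fun t : R^o => (fwd cm' m, coord_change cm' cm' m (v + t *: w))) 0
     (fun t => (0, (t : R) *: w)).
    have -> : (fun t : R^o => (fwd cm' m, coord_change cm' cm' m (v + t *: w))) =
       (fun t : R^o => (fwd cm' m, v + t *: w)).
      by apply/funext => t; rewrite (coord_change_id mM).
    exact: has_diff_pair (has_diff_cst _ _) (has_diff_line v w 0).
  by rewrite -[RHS]/((0, w) : F * F) -[X in (_, X)]scale1r -H.2.
have -> : vdiff TA L (m, v) (0, w) = 'd (chart_lagrangian cm') (fwd (TC cm') (m, v)) (0, w).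
  by [].
have H1 := has_diff_fibre v Am dm; have H2 := has_diff_fibre v Ac cm.
apply: etrans (has_diff_unique H1 H2 w).
by rewrite (coord_change_id mM w Am dm).
Qed.

Lemma energyE c (u : tangent MA) : atlas MA c -> dom c u.1 ->
  energy L u = loc_energy (chart_lagrangian c) (fwd (TC c) u).
Proof.
move=> Ac cu; have EL : L u = chart_lagrangian c (fwd (TC c) u).
  by rewrite -[in LHS](tangent_bwdK mM Ac cu).
by rewrite /energy (vdiff_vertical_lift _ Ac cu) [X in _ - X]EL.
Qed.

Lemma hessianE c m v a b : atlas MA c -> dom c m ->
  hessian L ((m, v) : tangent MA) a b =
  hess (chart_lagrangian c) (fwd (TC c) (m, v))
    (0, coord_change (chart_at MA m) c m a)
    (0, coord_change (chart_at MA m) c m b).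
Proof.
move=> Ac cm; have [Am dm] := chart_atP mM m.
set T := coord_change (chart_at MA m) c m.
have Hline (w : F) : has_diff (fun t : R^o => (t : R) *: w) 0 (fun t => (t : R) *: w).
  apply: has_diff_eq (has_diff_scale (has_diff_id (0 : R^o)) (has_diff_cst w _)) _.
  by move=> t; rewrite scaler0 add0r.
have H (s : R) : derive1 (fun t : R => L (m, v + s *: a + t *: b)) 0 =
    'd (chart_lagrangian c) (fwd (TC c) (m, v + s *: a)) (0, T b).
  have Hf : has_diff (fun w => L (m, v + s *: a + w)) ((0 : R) *: b)
      (fun w => 'd (chart_lagrangian c) (fwd (TC c) (m, v + s *: a)) (0, T w)).
    by rewrite scale0r; exact: has_diff_fibre.
  have [_ ->] := has_diff_derive1 (has_diff_comp (Hline b) Hf).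
  by rewrite scale1r.
rewrite /hessian; have -> : (fun s : R => derive1 (fun t : R => L (m, v + s *: a + t *: b)) 0)
    = (fun s : R => 'd (chart_lagrangian c) (fwd (TC c) (m, v + s *: a)) (0, T b)).
  by apply/funext => s; exact: H.
have cT : continuous T.
  exact: diff_continuous (transition_diff mM Am Ac dm cm).1.
have H1 : has_diff (fun s : R^o => (fwd c m, T (v + (s : R) *: a))) 0
    (fun s => (0, T ((s : R) *: a))).
  apply: has_diff_pair; first exact: has_diff_cst.
  exact: has_diff_comp (has_diff_line v a 0) (has_diff_linear _ cT).
have Wz : chart_fibres c (fwd (TC c) (m, v + (0 : R) *: a)) by exists m.
have H2 := has_diff_comp H1 (has_diff_diff (smooth_differentiable
  (smooth_diff (0, T b) (smooth_chart_lagrangian Ac)) Wz)).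
have [_ ->] := has_diff_derive1 H2.
by rewrite scale0r addr0 scale1r.
Qed.

End LagrangianInCharts.

(** * The action and its fundamental vector fields in a chart *)

Section ActionInCharts.
Context {R : realType} {K F : normedModType R} {G : topGroupType} {M : topologicalType}.
Variables (GA : manifold_data K G) (MA : manifold_data F M).
Variables (exp : K -> G) (act : G -> M -> M).
Hypothesis mG : smooth_manifold GA.
Hypothesis mM : smooth_manifold MA.
Hypothesis fF : finite_dim F.
Hypothesis expP : is_exp GA exp.
Hypothesis actP : smooth_left_action GA MA act.
Local Notation TC := (@tangent_chart R F M MA).
Implicit Types (cg : chart K G) (c : chart F M).

Definition act_dom cg c c' : set (K * F) :=
  fwd (prod_chart cg c) @`
    (dom (prod_chart cg c) `&` setT `&` (fun x => act x.1 x.2) @^-1` dom c').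

Definition act_loc cg c c' (p : K * F) : F :=
  fwd c' (act (bwd cg p.1) (bwd c p.2)).

Lemma act_smooth cg c c' : atlas GA cg -> atlas MA c -> atlas MA c' ->
  open (act_dom cg c c') /\ smooth_on (act_dom cg c c') (act_loc cg c c').
Proof.
move=> Ag Ac Ac'; have [sact _ _] := actP.
by apply: (sact (prod_chart cg c) c') => //; exists cg, c.
Qed.

Lemma mem_act_dom cg c c' g m : dom cg g -> dom c m -> dom c' (act g m) ->
  act_dom cg c c' (fwd cg g, fwd c m).
Proof. by move=> gd cm c'm; exists (g, m). Qed.

Lemma act_domP cg c c' p : act_dom cg c c' p ->
  exists g m, [/\ dom cg g, dom c m, dom c' (act g m) & p = (fwd cg g, fwd c m)].
Proof. by move=> [[g m] [[[gd cm] _] c'm] <-]; exists g, m. Qed.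

Lemma act_locE cg c c' g m : atlas GA cg -> atlas MA c -> dom cg g -> dom c m ->
  act_loc cg c c' (fwd cg g, fwd c m) = fwd c' (act g m).
Proof. by move=> Ag Ac gd cm; rewrite /act_loc/= (chart_bwdK mG)// (chart_bwdK mM). Qed.

Lemma left_act1 m : act 1%g m = m. Proof. by have [_ + _] := actP; exact. Qed.

Lemma near_act cg c c' g m : atlas GA cg -> atlas MA c -> atlas MA c' ->
  dom cg g -> dom c m -> dom c' (act g m) ->
  \forall y \near fwd c m, dom c' (act g (bwd c y)).
Proof.
move=> Ag Ac Ac' gd cm c'm; have [oA _] := act_smooth Ag Ac Ac'.
have co : continuous (fun y : F => (fwd cg g, y)).
  by move=> y; exact: differentiable_continuous (has_diff_pair_r (fwd cg g) y).1.
have H := mem_act_dom gd cm c'm.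
have : \forall y \near fwd c m, act_dom cg c c' (fwd cg g, y).
  by apply: (co (fwd c m)); exact: open_nbhs_nbhs.
apply: filterS2 (near_bwd mM Ac (open_dom mM Ac) cm cm) => y [yE cy _] Hy.
have [g' [m' [gd' cm' c'm' [gE mE]]]] := act_domP Hy.
have gg : g' = g by rewrite -(chart_bwdK mG Ag gd) gE (chart_bwdK mG).
by rewrite mE (chart_bwdK mM)// -gg.
Qed.

Lemma act_slice cg c c' g m : atlas GA cg -> atlas MA c -> atlas MA c' ->
  dom cg g -> dom c m -> dom c' (act g m) ->
  has_diff ((fwd c' \o act g) \o bwd c) (fwd c m)
    (fun v => 'd (act_loc cg c c') (fwd cg g, fwd c m) (0, v)).
Proof.
move=> Ag Ac Ac' gd cm c'm; have [oA sA] := act_smooth Ag Ac Ac'.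
have -> : (fwd c' \o act g) \o bwd c = (fun y => act_loc cg c c' (fwd cg g, y)).
  by apply/funext => y; rewrite /act_loc /= (chart_bwdK mG).
apply: has_diff_comp (has_diff_pair_r (fwd cg g) (fwd c m)) _.
apply: has_diff_diff; apply: (smooth_differentiable sA).
exact: mem_act_dom.
Qed.

(** [tangent_map] uses the preferred charts at m and at act g m; passing to c on
    both sides gives the differential of the action in coordinates. *)
Lemma tangent_map_chart cg c g m w : atlas GA cg -> atlas MA c ->
  dom cg g -> dom c m -> dom c (act g m) ->
  fwd (TC c) (tangent_map (act g) ((m, w) : tangent MA)) =
  (act_loc cg c c (fwd cg g, fwd c m),
   'd (act_loc cg c c) (fwd cg g, fwd c m)
     (0, coord_change (chart_at MA m) c m w)).
Proof.
move=> Ag Ac gd cm cgm; rewrite act_locE//.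
have [Am dm] := chart_atP mM m; have [Agm dgm] := chart_atP mM (act g m).
set cm' := chart_at MA m; set cgm' := chart_at MA (act g m).
have H1 := act_slice Ag Am Agm gd dm dgm.
have hE : (act g \o bwd cm') (fwd cm' m) = act g m.
  by rewrite /= (chart_bwdK mM).
have Hd : dom c ((act g \o bwd cm') (fwd cm' m)) by rewrite hE.
have H2 := target_change mM Agm Ac Hd (near_act Ag Am Agm gd dm dgm) H1.1.
rewrite hE in H2.
have H3 := source_change mM Ac Am cm dm (act_slice Ag Ac Ac gd cm cgm).1.
have E := has_diff_unique H2 H3 w.
rewrite tangent_fwdE /=; congr pair.
apply: etrans E _; have [_ ->] := act_slice Ag Ac Ac gd cm cgm.
by [].
Qed.

Lemma exp0 xi : exp (0 *: xi) = 1%g.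
Proof.
have [_ H _] := expP xi; have := H 0 0; rewrite addr0 => E.
by apply: (mulgI (exp (0 *: xi))); rewrite mulg1 -E.
Qed.

Lemma exp_curve xi : let cg := chart_at GA 1%g in
  has_diff (fun t : R^o => fwd cg (exp (t *: xi))) 0 (fun t => (t : R) *: xi) /\
  \forall t \near (0 : R^o), dom cg (exp (t *: xi)).
Proof.
move=> cg; have [Ag dg] := chart_atP mG 1%g; have [se _ ve] := expP xi.
have [|oD sD] := se (id_chart R^o) cg erefl; first exact: Ag.
rewrite /= setTI in oD sD.
set D := _ @` _ in oD sD.
have DE t : D t -> dom cg (exp (t *: xi)) by move=> [s [_ ds] <-].
have D0 : D 0 by exists 0 => //; split=> //; rewrite /preimage /= exp0.
split; last first.
  by apply: filterS (open_nbhs_nbhs (conj oD D0)) => t; exact: DE.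
apply: has_diff_eq (has_diff_diff (smooth_differentiable sD D0)) _ => t.
rewrite diff_scalar; congr (_ *: _).
by move: ve; rewrite /velocity /mdiff /= exp0.
Qed.

(** The curve t |-> exp (t xi) m, followed by any chart, is the action in
    coordinates applied to a curve with velocity xi at the unit. *)
Lemma orbit_curve c c' m xi : atlas MA c -> atlas MA c' -> dom c m -> dom c' m ->
  let cg := chart_at GA 1%g in
  has_diff (fwd c' \o (fun t : R^o => act (exp (t *: xi)) m)) 0
    (fun t => 'd (act_loc cg c c') (fwd cg 1%g, fwd c m) ((t : R) *: xi, 0)) /\
  \forall t \near (0 : R^o), dom c' (act (exp (t *: xi)) m).
Proof.
move=> Ac Ac' cm c'm cg; have [Ag dg] := chart_atP mG 1%g.
have [oA sA] := act_smooth Ag Ac Ac'; have [He ne] := exp_curve xi.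
have Hp := has_diff_pair He (has_diff_cst (fwd c m) (0 : R^o)).
have A0 : act_dom cg c c' (fwd cg (exp ((0 : R) *: xi)), fwd c m).
  by rewrite exp0; apply: mem_act_dom; rewrite ?left_act1.
have HA := has_diff_comp Hp (has_diff_diff (smooth_differentiable sA A0)).
have nA : \forall t \near (0 : R^o),
    act_dom cg c c' (fwd cg (exp ((t : R) *: xi)), fwd c m).
  by apply: (differentiable_continuous Hp.1); exact: open_nbhs_nbhs.
rewrite exp0 in HA; split.
  apply: has_diff_near HA; apply: filterS ne => t dt.
  by rewrite act_locE.
apply: filterS2 ne nA => t dt /act_domP[g' [m' [gd' cm' c'm' [gE mE]]]].
rewrite -(chart_bwdK mM Ac cm) mE (chart_bwdK mM)//.
by rewrite -(chart_bwdK mG Ag dt) gE (chart_bwdK mG).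
Qed.

Lemma fundE c m xi : atlas MA c -> dom c m ->
  let cg := chart_at GA 1%g in
  coord_change (chart_at MA m) c m (fund MA exp act xi m) =
  gen_field (act_loc cg c c) (fwd cg 1%g) xi (fwd c m).
Proof.
move=> Ac cm cg; have [Am dm] := chart_atP mM m.
set cm' := chart_at MA m.
have [H1 n1] := orbit_curve xi Ac Am cm dm.
have [H2 _] := orbit_curve xi Ac Ac cm cm.
have hE : act (exp ((0 : R) *: xi)) m = m by rewrite exp0 left_act1.
have Hd : dom c (act (exp ((0 : R) *: xi)) m) by rewrite hE.
have H3 := target_change mM Am Ac Hd n1 H1.1.
apply: etrans (etrans (has_diff_unique H3 H2 1) _); last by rewrite /= scale1r.
rewrite /= hE; congr coord_change.
by rewrite /fund /generator /velocity /mdiff /= /one_param hE.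
Qed.

(** In the chart, the tangent action along exp (t xi) is t |-> (B, 'd B (0, v)) at the
    point (exp (t xi), m), which is then differentiated at 0. *)
Lemma fund_completeE m v xi : let cg := chart_at GA 1%g in
  let c := chart_at MA m in
  fund_complete exp act xi ((m, v) : tangent MA) =
  gen_lift (act_loc cg c c) (fwd cg 1%g) xi (fwd (TC c) (m, v)).
Proof.
move=> cg c; have [Ac cm] := chart_atP mM m; have [Ag dg] := chart_atP mG 1%g.
have [H1 n1] := orbit_curve xi Ac Ac cm cm; have [He ne] := exp_curve xi.
have [oA sA] := act_smooth Ag Ac Ac.
set B := act_loc cg c c in H1 sA *.
have A0 : act_dom cg c c (fwd cg 1%g, fwd c m).
  by apply: mem_act_dom; rewrite ?left_act1.
have e0 : fwd cg (exp ((0 : R) *: xi)) = fwd cg 1%g by rewrite exp0.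
pose w := coord_change c c m v.
have HdB : has_diff (fun p => 'd B p (0, w)) (fwd cg (exp ((0 : R) *: xi)), fwd c m)
    ('d (fun p => 'd B p (0, w)) (fwd cg 1%g, fwd c m)).
  rewrite e0; apply: has_diff_diff.
  exact: smooth_differentiable (smooth_diff _ sA) A0.
have Hp := has_diff_pair He (has_diff_cst (fwd c m) (0 : R^o)).
have H2 := has_diff_comp Hp HdB.
have H3 : has_diff (fun t : R^o => fwd (TC c) (tangent_map (act (exp (t *: xi))) ((m, v) : tangent MA))) 0
   (fun t => ('d B (fwd cg 1%g, fwd c m) ((t : R) *: xi, 0),
     'd (fun p => 'd B p (0, w)) (fwd cg 1%g, fwd c m) ((t : R) *: xi, 0))).
  apply: has_diff_near (has_diff_pair H1 H2).
  apply: filterS2 ne n1 => t dt ct.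
  by rewrite (tangent_map_chart _ Ag Ac dt cm ct) act_locE.
have hE : act (exp ((0 : R) *: xi)) m = m by rewrite exp0 left_act1.
transitivity ('d (fun t : R^o => fwd (TC c) (tangent_map (act (exp (t *: xi))) ((m, v) : tangent MA))) 0 1).
  rewrite /fund_complete /complete_lift /generator /velocity /mdiff /= /one_param.
  by rewrite hE.
have [_ ->] := H3; rewrite scale1r /gen_lift; congr pair.
have Dg0 x : (fwd c @` dom c) x -> act_dom cg c c (fwd cg 1%g, x).
  by move=> [m' cm' <-]; apply: mem_act_dom; rewrite ?left_act1.
have Ox : (fwd c @` dom c) (fwd c m) by exists m.
exact: esym (dgen_fieldE fF oA sA Dg0 xi w Ox).
Qed.

End ActionInCharts.

(** * Relative equilibria and critical points *)

Section LocalLagrangianSystem.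
Context {R : realType} {K F : normedModType R} {G : topGroupType} {M : topologicalType}.
Variables (GA : manifold_data K G) (MA : manifold_data F M).
Variables (exp : K -> G) (act : G -> M -> M) (L : tangent MA -> R^o).
Hypothesis mG : smooth_manifold GA.
Hypothesis mM : smooth_manifold MA.
Hypothesis fF : finite_dim F.
Hypothesis expP : is_exp GA exp.
Hypothesis actP : smooth_left_action GA MA act.
Hypothesis sL : msmooth (tangent_data MA) (model_data R^o) L.
Hypothesis invL : invariant_lagrangian act L.
Local Notation TC := (@tangent_chart R F M MA).
Variable c : chart F M.
Hypothesis Ac : atlas MA c.

Let cg := chart_at GA 1%g.
Let O := fwd c @` dom c.

Lemma act_dom1 x : O x -> act_dom act cg c c (fwd cg 1%g, x).
Proof.
have [Ag dg] := chart_atP mG 1%g.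
by move=> [m cm <-]; apply: mem_act_dom; rewrite ?(left_act1 actP).
Qed.

Lemma act_loc1 x : O x -> act_loc act cg c c (fwd cg 1%g, x) = x.
Proof.
have [Ag dg] := chart_atP mG 1%g.
by move=> [m cm <-]; rewrite (act_locE act mG mM c Ag Ac dg cm) (left_act1 actP).
Qed.

Lemma act_loc_codom p : act_dom act cg c c p -> O p.2 -> O (act_loc act cg c c p).
Proof.
have [Ag _] := chart_atP mG 1%g.
move=> /act_domP[g [m [dg cm cgm ->]]] _.
by rewrite (act_locE act mG mM c Ag Ac dg cm); exists (act g m).
Qed.

Lemma chart_invariance p v : act_dom act cg c c p -> O p.2 ->
  chart_lagrangian L c (act_loc act cg c c p, 'd (act_loc act cg c c) p (0, v)) =
  chart_lagrangian L c (p.2, v).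
Proof.
have [Ag _] := chart_atP mG 1%g.
move=> /act_domP[g [m [dg cm cgm pE]]] _; have [Am dm] := chart_atP mM m.
rewrite pE; set w := coord_change c (chart_at MA m) m v.
have E := tangent_map_chart mG mM actP w Ag Ac dg cm cgm.
rewrite (coord_change_trans mM)// (coord_change_id mM)// in E.
rewrite /chart_lagrangian /comp -E (tangent_bwdK mM)//.
by rewrite invL tangent_bwdE.
Qed.

Lemma momentumE (u : tangent MA) eta : dom c u.1 ->
  momentum L exp act u eta =
  loc_mom (chart_lagrangian L c) (act_loc act cg c c) (fwd cg 1%g) eta (fwd (TC c) u).
Proof.
move=> cu.
rewrite /momentum /fund_vertical (vdiff_vertical_lift mM sL _ Ac cu).
by rewrite (fundE mG mM expP actP eta Ac cu).
Qed.

Lemma gramE k (E : 'I_k -> K) m v : dom c m ->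
  gram (chart_lagrangian L c) (act_loc act cg c c) (fwd cg 1%g) E (fwd (TC c) (m, v)) =
  \matrix_(a < k, b < k) hessian L ((m, v) : tangent MA)
     (fund MA exp act (E a) m) (fund MA exp act (E b) m).
Proof.
move=> cm; apply/matrixP => a b; rewrite [LHS]mxE [RHS]mxE.
rewrite (hessianE mM sL _ _ _ Ac cm).
by rewrite !(fundE mG mM expP actP _ Ac cm).
Qed.

Lemma curve_to_chart (gamma : R -> tangent MA) (eps : R) : 0 < eps ->
  msmooth_on (model_data R^o) (tangent_data MA) `]- eps, eps[ gamma ->
  dom c (gamma 0).1 ->
  differentiable (fwd (TC c) \o gamma : R^o -> _) 0 /\
  \forall t \near (0 : R^o), `]- eps, eps[%classic t /\ dom c (gamma t).1.
Proof.
move=> eps0 sg c0.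
have [|//|oD sD] := sg (id_chart R^o) (TC c); first by [].
  by exists c.
set D := _ @` _ in oD sD.
have D0 : D 0.
  by exists 0 => //; split=> //; split=> //; rewrite /= in_itv /= oppr_lt0 eps0.
split; first exact: (smooth_differentiable sD D0).
apply: filterS (open_nbhs_nbhs (conj oD D0)) => _ [t [[_ It] ct] <-].
by split.
Qed.

(** In another natural chart the curve is z followed by a transition map of TM. *)
Lemma curve_of_chart (z : R^o -> F * F) (eps : R) :
  smooth_on [set t : R^o | `|t| < eps] z ->
  (forall t : R, `|t| < eps -> chart_fibres c (z t)) ->
  msmooth_on (model_data R^o) (tangent_data MA) `]- eps, eps[
    (fun t => bwd (TC c) (z t)).
Proof.
move=> sz zW _ _ -> [d Ad <-] D.
pose I := [set t : R^o | `|t| < eps].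
have oI : open I by exact: open_norm_lt.
have oW := open_dom2 mM Ac Ad.
have DE : D = I `&` z @^-1` dom2 c d.
  apply/seteqP; split=> [_ [t [[_ It] dt] <-]|t [It zt]].
    have It' : I t by move: It; rewrite /= in_itv /= -ltr_norml.
    split=> //; rewrite /dom2 /=; have [ct tK] := tangent_fwdK mM Ac (zW t It').
    by exists (bwd (TC c) (z t)).1 => //; rewrite -[in RHS]tK.
  exists t => //; split; first by split=> //; rewrite /= in_itv /= -ltr_norml.
  have [m [cm dm] mE] := zt; rewrite /preimage /=.
  by rewrite -mE (chart_bwdK mM).
have oD : open D.
  rewrite DE openE => t [It zt]; rewrite /interior; apply: filterI.
    exact: open_nbhs_nbhs.
  by apply: (smooth_continuous sz It); exact: open_nbhs_nbhs.
split=> //.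
apply: (@smooth_comp R _ _ _ D (dom2 c d) z (fwd (TC d) \o bwd (TC c))) => //.
- exact: finite_dim_prod.
- by rewrite DE => t [].
- by apply: smooth_subset sz; rewrite DE => t [].
- exact: smooth_tangent_transition.
Qed.

End LocalLagrangianSystem.

(** The Euler-Lagrange equations are given along the coordinate directions; both
    sides are linear in the direction, whence the equation along every b. *)
Lemma euler_lagrange_chart (R : realType) n (M : topologicalType)
    (MA : manifold_data 'rV[R]_n M) (L : tangent MA -> R^o) Gamma m v :
  smooth_manifold MA -> msmooth (tangent_data MA) (model_data R^o) L ->
  euler_lagrange_field L Gamma ->
  let c := chart_at MA m in
  let z := fwd (tangent_chart MA c) (m, v) in
  (Gamma (m, v)).1 = z.2 /\
  forall b, hess (chart_lagrangian L c) z (Gamma (m, v)) (0, b) =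
            'd (chart_lagrangian L c) z (b, 0).
Proof.
move=> mM sL EL c z; have [Ac cm] := chart_atP mM m.
set Gu := Gamma (m, v).
pose TC := tangent_chart MA c.
have sLc := smooth_chart_lagrangian mM sL Ac.
have oW : open (chart_fibres c).
  by apply: open_comp; [move=> ? _; exact: cvg_fst|exact: (open_chart_codom mM Ac)].
have Wz : chart_fibres c z by exists m.
have nW : \forall y \near z, chart_fibres c y by exact: open_nbhs_nbhs.
have [E1 E2] := EL c Ac (m, v) cm.
(* Both equations differentiate a function given through the chart; composed
   with the inverse chart it can be replaced near z by its coordinate form. *)
have step (W : normedModType R) (f g : 'rV[R]_n * 'rV[R]_n -> W) D :
    (forall y, chart_fibres c y -> f y = g y) -> has_diff g z D ->
    vdiff (tangent_data MA) (fun w => f (fwd TC w)) (m, v) Gu = D Gu.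
  move=> fg Hg; suff [_ E] : has_diff (fun y => f (fwd TC (bwd TC y))) z D by exact: E.
  apply: has_diff_near Hg; apply: filterS nW => y Wy.
  by have [_ ->] := tangent_fwdK mM Ac Wy; rewrite fg.
split.
  by rewrite -[RHS]E1; apply/esym; apply: (step _ fst fst) => //; exact: has_diff_fst.
have Hi i : hess (chart_lagrangian L c) z Gu (0, delta_mx 0 i) =
    'd (chart_lagrangian L c) z (delta_mx 0 i, 0).
  transitivity ('D_((delta_mx 0 i, 0) : 'rV[R]_n * 'rV[R]_n) (chart_lagrangian L c) z).
    rewrite -[RHS](E2 i); apply/esym; rewrite /hess.
    pose f y := 'D_((0, delta_mx 0 i) : 'rV[R]_n * 'rV[R]_n) (chart_lagrangian L c) y.
    pose g y := 'd (chart_lagrangian L c) y (0, delta_mx 0 i).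
    have fg y : chart_fibres c y -> f y = g y.
      by move=> Wy; apply: deriveE; exact: (smooth_differentiable sLc Wy).
    exact: (step R^o f g _ fg
      (has_diff_diff (smooth_differentiable (smooth_diff _ sLc) Wz))).
  by rewrite deriveE//; exact: (smooth_differentiable sLc Wz).
move=> b.
have oO := open_chart_codom mM Ac.
have l1 := hess_linear oO sLc Gu Wz.
have l2 : linear (fun b : 'rV[R]_n => (0, b) : 'rV[R]_n * 'rV[R]_n).
  by move=> r x y; congr pair; rewrite /= scaler0 addr0.
have l3 : linear (fun b : 'rV[R]_n => (b, 0) : 'rV[R]_n * 'rV[R]_n).
  by move=> r x y; congr pair; rewrite /= scaler0 addr0.
transitivity (linear_map l1 (linear_map l2 b)) => //.
transitivity ('d (chart_lagrangian L c) z (linear_map l3 b)) => //.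
rewrite {1 2}[b]row_sum_delta !linear_sum; apply: eq_bigr => i _.
rewrite !linearZ; congr (_ *: _); exact: Hi.
Qed.

Lemma basis_span (R : realType) k (E : k.-tuple 'rV[R]_k) (eta : 'rV[R]_k) :
  basis_of fullv E -> exists c : 'I_k -> R, eta = \sum_a c a *: tnth E a.
Proof.
move=> bE; exists (fun a => coord E a eta).
rewrite [LHS](coord_basis bE (memvf eta)); apply: eq_bigr => a _.
by rewrite (tnth_nth 0).
Qed.

Theorem mainTheorem1 (R : realType) (k n : nat)
  (G : topGroupType) (GA : manifold_data 'rV[R]_k G)
  (M : topologicalType) (MA : manifold_data 'rV[R]_n M)
  (exp : 'rV[R]_k -> G) (act : G -> M -> M)
  (L : tangent MA -> R^o)
  (E : k.-tuple 'rV[R]_k)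
  (Gamma : tangent MA -> 'rV[R]_n * 'rV[R]_n) :
  lie_group GA ->
  connected [set: G] ->
  is_exp GA exp ->
  smooth_manifold MA ->
  smooth_left_action GA MA act ->
  free_action act ->
  proper_action act ->
  msmooth (tangent_data MA) (model_data R^o) L ->
  invariant_lagrangian act L ->
  regular L ->
  basis_of fullv E ->
  (forall u : tangent MA,
     (\matrix_(a < k, b < k)
        hessian L u (fund MA exp act (tnth E a) u.1)
                    (fund MA exp act (tnth E b) u.1)) \in unitmx) ->
  euler_lagrange_field L Gamma ->
  forall (mu : {linear 'rV[R]_k -> R^o}) (u : tangent MA),
    momentum_level L exp act mu u ->
    (relative_equilibrium exp act Gamma u <->
     critical_point_on (tangent_data MA) (momentum_level L exp act mu)
                       (energy L) u).
Proof.
move=> [mG _ _] _ expP mM actP _ _ sL invL regL bE gramU EL mu [m v] uN.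
have [Ac cm] := chart_atP mM m; have [Ag dg] := chart_atP mG 1%g.
set c := chart_at MA m in Ac cm; set cg := chart_at GA 1%g in Ag dg.
pose TC := tangent_chart MA c.
pose Lc := chart_lagrangian L c; pose B := act_loc act cg c c.
pose g0 := fwd cg 1%g; pose z0 := fwd TC (m, v).
have fF := @finite_dim_rV R n; have fK := @finite_dim_rV R k.
have oO := open_chart_codom mM Ac.
have sLc : smooth_on (chart_fibres c) Lc := smooth_chart_lagrangian mM sL Ac.
have [oD sB] := act_smooth actP Ag Ac Ac.
have D1 := act_dom1 mG actP (c := c).
have B1 := act_loc1 mG mM actP Ac.
have BO := act_loc_codom mG mM (act := act) Ac.
have inv := chart_invariance mG mM actP invL Ac.
have momE := momentumE mG mM expP actP sL Ac.
have enE := energyE mM sL Ac.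
have Wz0 : chart_fibres c z0 by exists m.
have [G1 GE] := @euler_lagrange_chart R n M MA L Gamma m v mM sL EL.
have liftE xi := fund_completeE mG mM fF expP actP m v xi.
have spanE eta := basis_span eta bE.
have gU : gram Lc B g0 (tnth E) z0 \in unitmx.
  by rewrite (gramE mG mM expP actP sL Ac)//; exact: gramU (m, v).
have reg w : (forall w', hess Lc z0 (0, w) (0, w') = 0) -> w = 0.
  move=> Hw; apply: (regL (m, v)) => w'.
  by rewrite (hessianE mM sL _ _ _ Ac cm) !(coord_change_id mM).
have kerE := equilibrium_of_kernel fF fK oO sLc oD sB D1 B1 BO inv spanE
  Wz0 gU reg G1 GE.
have momz0 eta : loc_mom Lc B g0 eta z0 = mu eta.
  by rewrite -[RHS](uN eta) (momE (m, v)).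
split=> [[xi Gxi]|[_ crit]].
  split=> // gamma eps eps0 sg gN g0E.
  have cg0 : Defs.dom c (gamma 0).1 by rewrite g0E.
  have [dz nz] := curve_to_chart Ac eps0 sg cg0.
  pose z := fwd TC \o gamma.
  have z0E : z 0 = z0 by rewrite /z /= g0E.
  have Hz : has_diff (z : R^o -> _) 0 _ := has_diff_diff dz.
  have dmom0 eta : 'd (loc_mom Lc B g0 eta) z0 ('d (z : R^o -> _) 0 1) = 0.
    have Hm : has_diff (loc_mom Lc B g0 eta) (z 0) ('d (loc_mom Lc B g0 eta) z0).
      rewrite z0E; apply: has_diff_diff.
      exact: smooth_differentiable (smooth_loc_mom fF fK oO sLc oD sB D1 eta) Wz0.
    have H1 := has_diff_comp Hz Hm.
    have H2 : has_diff (fun t : R^o => loc_mom Lc B g0 eta (z t)) 0 (fun=> 0).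
      apply: has_diff_near (has_diff_cst (mu eta : R^o) _).
      by apply: filterS nz => t [It ct]; rewrite -(gN t It eta) momE.
    exact: has_diff_unique H1 H2 1.
  have He : has_diff (loc_energy Lc) (z 0) ('d (loc_energy Lc) z0).
    by rewrite z0E; have [? _] := has_diff_energy fF sLc Wz0.
  have : has_diff (energy L \o gamma : R^o -> R^o) 0
     (fun t => 'd (loc_energy Lc) z0 ('d (z : R^o -> _) 0 t)).
    apply: has_diff_near (has_diff_comp Hz He).
    by apply: filterS nz => t [It ct]; rewrite /= enE.
  move=> /has_diff_derive1[_ ->].
  apply: (kernel_of_equilibrium fF fK oO sLc oD sB D1 B1 BO inv Wz0 G1 GE _ dmom0).
  by rewrite Gxi liftE.
have [b kerb|xi xiE] := kerE; last by exists xi; rewrite liftE.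
have [eps [z [eps0 sz zz0 dz zN]]] :=
  level_curve fF fK oO sLc oD sB D1 spanE Wz0 gU kerb.
pose gamma (t : R) : tangent MA := bwd TC (z t).
have zW (t : R) : `|t| < eps -> chart_fibres c (z t) by move=> /zN[].
have gK (t : R) : `|t| < eps -> Defs.dom c (gamma t).1 /\ fwd TC (gamma t) = z t.
  by move=> /zW; exact: tangent_fwdK.
have g0E : gamma 0 = (m, v) by rewrite /gamma zz0 (tangent_bwdK mM).
have := crit gamma eps eps0 (curve_of_chart mM fF Ac sz zW) _ g0E.
have gN (t : R) : `]- eps, eps[%classic t -> momentum_level L exp act mu (gamma t).
  rewrite /= in_itv /= -ltr_norml => It eta; have [ct tK] := gK t It.
  have [_ zmu] := zN t It.
  by rewrite momE// tK zmu momz0.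
move=> /(_ gN).
have He : has_diff (loc_energy Lc) (z 0) ('d (loc_energy Lc) z0).
  by rewrite zz0; have [? _] := has_diff_energy fF sLc Wz0.
have : has_diff (energy L \o gamma : R^o -> R^o) 0
   (fun t => 'd (loc_energy Lc) z0 ((t : R) *: b)).
  apply: has_diff_near (has_diff_comp dz He).
  have : \forall t \near (0 : R^o), `|t| < eps.
    apply/nbhs_ballP; exists eps => //= t.
    by rewrite -ball_normE /= sub0r normrN.
  by apply: filterS => t It; have [ct tK] := gK t It; rewrite /= enE// tK.
by move=> /has_diff_derive1[_ ->]; rewrite scale1r.
Qed.
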